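(* Let $L$ be a Lelek fan. Then: 1. there is an embedding $f:L\to L$ which is not a homeomorphism of $L$ onto $L$ (i.e. $f(L)\neq L$) such that $f$ admits a retraction; 2. there is an embedding $f:L\to L$ that does not admit a retraction.
   Context: A continuum is a nonempty compact connected metric space. A dendroid is an arcwise connected, hereditarily unicoherent continuum. A point $x$ of a dendroid $X$ is a ramification point if $x$ is the top (the branch point) of some simple triod in $X$. A fan is a dendroid with at most one ramification point; this point, if it exists, is called the top of the fan. For a fan $X$, a point $x$ is an end point of $X$ if $x$ is an end point of every arc in $X$ containing $x$; $E(X)$ denotes the set of end points of $X$. A fan $X$ with top $v$ is smooth if for every $x\in X$ and every sequence $x_n\to x$ in $X$, the arcs from $v$ to $x_n$ converge (in the Hausdorff metric) to the arc from $v$ to $x$. A Lelek fan is a smooth fan $X$ with $\mathrm{Cl}(E(X))=X$. An embedding is a continuous map that is a homeomorphism onto its image. A retraction from a space $X$ onto a subspace $Y$ is a continuous map $r:X\to Y$ with $r(y)=y$ for all $y\in Y$; an embedding $f:X\to Z$ admits a retraction if there is a retraction from $Z$ onto $f(X)$. *)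

(* Defs.v *)
From HB Require Import structures.
From mathcomp Require Import all_boot all_order all_algebra.
From mathcomp Require Import all_classical all_reals all_analysis.
Set Implicit Arguments. Unset Strict Implicit. Unset Printing Implicit Defensive.
Import Order.TTheory GRing.Theory Num.Theory.
Import numFieldNormedType.Exports.
Local Open Scope classical_set_scope.
Local Open Scope ring_scope.

Section Continua.
Variables (R : realType) (T : pseudoMetricType R).

Definition metric_space := hausdorff_space T.

Definition continuum (A : set T) := A !=set0 /\ compact A /\ connected A.

Definition unit_itv : set R := [set t : R | 0 <= t <= 1].

Definition arc_between (A : set T) (a b : T) :=
  exists (g : R -> T) (h : T -> R),
    [/\ {within unit_itv, continuous g}, g @` unit_itv = A,
        {within A, continuous h}, (forall t, unit_itv t -> h (g t) = t) &
        g 0 = a /\ g 1 = b].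

Definition is_arc (A : set T) := exists a b, arc_between A a b.

Definition arc_endpoint (A : set T) (x : T) := exists b, arc_between A x b.

Definition arcwise_connected (X : set T) :=
  forall x y, X x -> X y -> x <> y -> exists2 A, A `<=` X & arc_between A x y.

Definition unicoherent (Y : set T) :=
  forall A B, continuum A -> continuum B -> A `|` B = Y -> connected (A `&` B).

Definition hereditarily_unicoherent (X : set T) :=
  forall Y, Y `<=` X -> continuum Y -> unicoherent Y.

Definition dendroid (X : set T) :=
  [/\ continuum X, arcwise_connected X & hereditarily_unicoherent X].

(* v is the top of a simple triod contained in X *)
Definition ramification_point (X : set T) (v : T) :=
  exists A1 A2 A3 : set T,
    [/\ A1 `<=` X, A2 `<=` X, A3 `<=` X,
        arc_endpoint A1 v /\ arc_endpoint A2 v /\ arc_endpoint A3 v &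
        [/\ A1 `&` A2 = [set v], A2 `&` A3 = [set v] & A1 `&` A3 = [set v]]].

Definition fan (X : set T) :=
  dendroid X /\ (forall v w, ramification_point X v -> ramification_point X w -> v = w).

Definition end_points (X : set T) : set T :=
  [set x | X x /\ forall A, A `<=` X -> is_arc A -> A x -> arc_endpoint A x].

Definition arc_from (X : set T) (v x : T) (A : set T) :=
  A `<=` X /\ (if pselect (x = v) then A = [set v] else arc_between A v x).

Definition set_nbhd (S : set T) (e : R) : set T :=
  [set y | exists2 a, S a & ball a e y].

Definition hausdorff_cvg (A : nat -> set T) (B : set T) :=
  forall e : R, 0 < e ->
    \forall n \near \oo, A n `<=` set_nbhd B e /\ B `<=` set_nbhd (A n) e.

Definition smooth_fan_top (X : set T) (v : T) :=
  [/\ fan X, ramification_point X v &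
      forall (x : T) (u : nat -> T) (A : nat -> set T) (B : set T),
        X x -> (forall n, X (u n)) -> u @ \oo --> x ->
        (forall n, arc_from X v (u n) (A n)) -> arc_from X v x B ->
        hausdorff_cvg A B].

Definition smooth_fan (X : set T) := exists v, smooth_fan_top X v.

Definition lelek_fan (X : set T) :=
  smooth_fan X /\ closure (end_points X) = X.

End Continua.

Section Maps.
Variables (R : realType) (T : pseudoMetricType R).

Definition embedding (f : T -> T) :=
  continuous f /\ exists g : T -> T, {within range f, continuous g} /\ cancel f g.

Definition retraction (Y : set T) (r : T -> T) :=
  [/\ continuous r, forall y, Y (r y) & forall y, Y y -> r y = y].

Definition admits_retraction (f : T -> T) := exists r, retraction (range f) r.
End Maps.

(* Main.v *)
(** In a smooth fan with top [v] the arc from [v] to [x] depends continuously on [x],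
so there is a continuous height [mu] with [mu v = 0] which increases along the legs.
By hereditary unicoherence no continuum missing [v] joins two legs, so the legs are
separated by countably many clopen subsets of the complement of [v]; they give every
leg a binary code.  Thus the complement of [v] is the set of pairs (code, height)
below an upper semicontinuous length function, and in a Lelek fan the lengths of the
legs near a given leg accumulate at every smaller height.

Second part: halve all heights.  If the half point x/2 is the limit of tips e, a
retraction r fixes e/2 and nearly fixes x/2, hence maps the segment from e/2 to e
through [v]; in the limit r sends some point between x/4 and x/2, which it fixes,
to [v].

First part: send the cylinders of codes to nested disjoint cylinders, choosing at each
stage (by density of tips) a cylinder whose longest leg is half of the longest leg of
the source up to a factor tending to 1.  In the limit this is an embedding which
halves heights exactly and maps each leg onto an entire leg.  Whatever a target
cylinder loses in passing to its two children is folded onto the image of one longest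
leg, and since the error factors tend to 1 the folding is continuous: it is a
retraction onto the image. *)
Require Import Defs.
From HB Require Import structures.
From mathcomp Require Import all_boot all_order all_algebra.
From mathcomp Require Import all_classical all_reals all_analysis.
From mathcomp Require Import ring lra.
Set Implicit Arguments. Unset Strict Implicit. Unset Printing Implicit Defensive.
Import Order.TTheory GRing.Theory Num.Theory.
Import numFieldNormedType.Exports.
Local Open Scope classical_set_scope.
Local Open Scope ring_scope.

(** * General topology *)

Lemma cluster_closed (T : topologicalType) (F : set_system T) (C : set T) :
  closed C -> F C -> cluster F `<=` C.
Proof. by move=> cC FC y; rewrite clusterE => /(_ C FC); exact: cC. Qed.

(** The conclusion is phrased through closed sets: later limits only need closed conditions that
    hold eventually to pass to one common point, so no subsequence is extracted. *)
Lemma compact_seq_cluster (T : topologicalType) (y : nat -> T) :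
  compact [set: T] ->
  exists z, forall C, closed C -> (\forall n \near \oo, C (y n)) -> C z.
Proof.
move=> cT; have [|z [_ cz]] := cT (y @ \oo); first exact: filterT.
by exists z => C cC yC; apply: cluster_closed cz.
Qed.

Lemma continuous_within_comp (X Y Z : topologicalType) (A : set X) (B : set Y)
    (f : X -> Y) (g : Y -> Z) :
  {within A, continuous f} -> {within B, continuous g} -> f @` A `<=` B ->
  {within A, continuous (g \o f)}.
Proof.
move=> /subspace_continuousP cf /subspace_continuousP cg fAB.
apply/subspace_continuousP => x Ax W gW.
have Bfx : B (f x) by apply: fAB; exists x.
have := cf x Ax _ (cg _ Bfx W gW).
rewrite /fmap /= !nbhs_simpl /= /within /=.
by apply: filterS => y H Ay; apply: H => //; apply: fAB; exists y.
Qed.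

Lemma connected_locally_constant (X : topologicalType) (C : set X)
    (p : X -> Prop) x y :
  connected C -> (forall z, C z -> \forall t \near z, p t <-> p z) ->
  C x -> C y -> p x -> p y.
Proof.
move=> cC loc Cx Cy px.
(* Both truth values of [p] are cut out on [C] by open sets [U b]; [True] and [False] make the truth
   set relatively open and relatively closed. *)
pose U (b : Prop) := [set t | \forall u \near t, C u -> (p u <-> b)]°.
have UE b : C `&` [set t | p t <-> b] = C `&` U b.
  apply/seteqP; split => t [Ct tb]; split => //; last first.
    by have /= := nbhs_singleton (interior_subset tb); exact.
  apply: nbhs_interior; apply: filterS (loc t Ct) => u up _.
  exact: iff_trans up tb.
suff CE : C `&` [set t | p t <-> True] = C.
  by have : (C `&` [set t | p t <-> True]) y; [rewrite CE|case=> _ [_]; exact].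
apply: cC; first by exists x; split => //=; tauto.
- by exists (U True); [exact: open_interior|exact: UE].
- exists (~` U False); first exact/open_closedC/open_interior.
  apply/seteqP; split => t [Ct tb]; split => //.
    move=> Ut; have : (C `&` U False) t by [].
    by rewrite -UE => -[_ /=]; move: tb => /=; tauto.
  rewrite /=; split => // _; apply: contrapT => np; apply: tb.
  have : (C `&` [set t | p t <-> False]) t by split => //=; tauto.
  by rewrite UE => -[].
Qed.

Lemma connected_closed_split (X : topologicalType) (C P Q : set X) x y :
  connected C -> closed P -> closed Q -> P `&` Q = set0 -> C `<=` P `|` Q ->
  C x -> P x -> C y -> Q y -> False.
Proof.
move=> cC clP clQ PQ CPQ Cx Px Cy Qy.
have sPQ : separated P Q.
  by split; rewrite -(closure_id _).1.
have PQ0 z : P z -> Q z -> False by move=> Pz Qz; have : (P `&` Q) z by []; rewrite PQ.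
by have [CP|CQ] := connected_subset sPQ CPQ cC; [exact: PQ0 (CP _ Cy) Qy|exact: PQ0 Px (CQ _ Cx)].
Qed.

(** If every member of [D] met [K], the traces on [K] would generate a proper filter, whose cluster
    point would lie in every member of [D]. *)
Lemma compact_directed_closed (X : topologicalType) (K : set X)
    (D : set (set X)) :
  compact K -> D !=set0 -> (forall E, D E -> closed E) ->
  (forall E F, D E -> D F -> exists2 G, D G & G `<=` E `&` F) ->
  (forall x, K x -> exists2 E, D E & ~ E x) ->
  exists2 E, D E & E `&` K = set0.
Proof.
move=> cK [E0 DE0] clD dirD KD; apply: contrapT => none.
pose F := filter_from D (fun E => E `&` K).
have FF : ProperFilter F.
  apply: filter_from_proper.
    apply: filter_from_filter; first by exists E0.
    move=> E1 E2 D1 D2; have [G DG GE] := dirD _ _ D1 D2; exists G => //.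
    by move=> x [/GE[? ?] Kx]; split.
  by move=> E DE; apply/set0P/eqP => EK; apply: none; exists E.
have [|x [Kx cx]] := cK F FF; first by exists E0 => // x [].
have [E DE nEx] := KD x Kx; apply: nEx; apply: clD => // B xB.
have FE : F (E `&` K) by exists E.
by have [y [[Ey _] By]] := cx _ _ FE xB; exists y.
Qed.

(** If no finite list sufficed, the uncovered remainders of [K] would generate a proper filter,
    since concatenating lists intersects remainders. A list of length one refutes a cluster
    point. *)
Lemma compact_finite_subcover (X : topologicalType) (K : set X) (I : Type)
    (i0 : I) (U : I -> set X) :
  compact K -> (forall x, K x -> exists i, nbhs x (U i)) ->
  exists l : seq I, forall x, K x ->
    exists2 j, (j < size l)%N & U (nth i0 l j) x.
Proof.
move=> cK KU; apply: contrapT => /forallNP none.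
pose V (l : seq I) := [set x | K x /\
  forall j, (j < size l)%N -> ~ U (nth i0 l j) x].
pose F := filter_from setT V.
have FF : ProperFilter F.
  apply: filter_from_proper.
    apply: filter_from_filter; first by exists [::].
    move=> l1 l2 _ _; exists (l1 ++ l2) => // x [Kx H]; split; split => // j jl.
      by have := H j; rewrite size_cat nth_cat jl; apply; rewrite ltn_addr.
    have := H (size l1 + j)%N; rewrite size_cat nth_cat ltn_add2l => /(_ jl).
    by rewrite ltnNge leq_addr /= addnC addnK.
  move=> l _; have /existsNP[x /not_implyP[Kx nx]] := none l.
  by exists x; split => // j jl Ux; apply: nx; exists j.
have [|x [Kx cx]] := cK F FF; first by exists [::] => // x [].
have [i Ui] := KU x Kx.
have Fi : F (V [:: i]) by exists [:: i].
by have [y [[_ /(_ 0%N erefl)]]] := cx _ _ Fi Ui.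
Qed.

(** Turns finite covers at all scales [m] into a single sequence; it yields a dense sequence and a
    countable family of sets separating the legs. *)
Lemma enumerate_lists (A : Type) (a0 : A) (l : nat -> seq A) :
  exists q : nat -> A,
    forall m j, (j < size (l m))%N -> exists k, q k = nth a0 (l m) j.
Proof.
exists (fun k => if unpickle k is Some (m, j) then nth a0 (l m) j else a0).
by move=> m j _; exists (pickle (m, j)); rewrite pickleK.
Qed.

(* The quasi-components of a compact space are connected. *)
Lemma compact_separation (R : realType) (X : pseudoMetricType R) (L P Q : set X) :
  compact [set: X] -> closed L -> closed P -> closed Q ->
  P `<=` L -> Q `<=` L ->
  (forall C x y, connected C -> C `<=` L -> C x -> P x -> C y -> Q y -> False) ->
  exists E, [/\ closed E, closed (L `\` E), E `<=` L, P `<=` E & E `&` Q = set0].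
Proof.
move=> cX clL clP clQ PL QL noC.
pose sep := [set E | [/\ closed E, closed (L `\` E) & E `<=` L]].
have sepT : sep L by split => //; rewrite setDv; exact: closed0.
have sepI E F : sep E -> sep F -> sep (E `&` F).
  move=> [clE clE' EL] [clF clF' FL]; split; first exact: closedI.
    by rewrite setDIr; exact: closedU.
  by move=> x [/EL].
have sepD E : sep E -> sep (L `\` E).
  move=> [clE clE' EL]; split => //.
  by rewrite setDD (setIidr EL).
have cpt (K : set X) : closed K -> compact K by move=> clK; exact: subclosed_compact clK cX _.
have quasi a : L a -> connected (\bigcap_(E in [set E | sep E /\ E a]) E).
  move=> La; set S := \bigcap_(_ in _) _.
  have clS : closed S by apply: closed_bigI => E [[clE _ _] _].
  have Sa : S a by move=> E [].
  (* Normality separates [P1] from [P2], compactness puts some relatively clopen [E] around [a]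
     inside the union of the two open sets, and removing [G2] from [E] leaves a relatively clopen
     set around [a] that misses [P2]. *)
  have key P1 P2 : closed P1 -> closed P2 -> P1 `&` P2 = set0 ->
      S = P1 `|` P2 -> P1 a -> P2 = set0.
    move=> cl1 cl2 P12 SP P1a.
    have [G1 [G2 [op1 op2 PG1 PG2 G12]]] :=
      (@normal_openP R X).1 pseudometric_normal _ _ cl1 cl2 P12.
    have [| | | | |E [sE Ea] EO] := @compact_directed_closed X (~` (G1 `|` G2))
        [set E | sep E /\ E a].
    - by apply: cpt; apply: open_closedC; exact: openU.
    - by exists L.
    - by move=> E [[clE _ _] _].
    - by move=> E F [sE Ea] [sF Fa]; exists (E `&` F) => //; split => //; exact: sepI.
    - move=> x nO; apply: contrapT => H; apply: nO.
      have : S x by move=> E [sE Ea]; apply: contrapT => nE; apply: H; exists E.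
      by rewrite SP => -[/PG1|/PG2]; [left|right].
    have EO' x : E x -> G1 x \/ G2 x.
      move=> Ex; apply: contrapT => nO.
      by have : (E `&` ~` (G1 `|` G2)) x by []; rewrite EO.
    have sE1 : sep (E `&` ~` G2).
      have [clE clE' EL] := sE; split.
      - by apply: closedI => //; exact: open_closedC.
      - have -> : L `\` (E `&` ~` G2) = (L `\` E) `|` (E `&` ~` G1).
          apply/seteqP; split => x.
            move=> [Lx nx]; have [Ex|nEx] := pselect (E x); last by left.
            right; split => // O1x; apply: nx; split => // O2x.
            by have : (G1 `&` G2) x by []; rewrite G12.
          move=> [[Lx nE]|[Ex nG1]]; split => //; [by case|exact: EL|].
          by case=> _; apply; have [] := EO' x Ex.
        by apply: closedU => //; apply: closedI => //; exact: open_closedC.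
      - by move=> x [/EL].
    apply/seteqP; split => // x P2x.
    have Sx : S x by rewrite SP; right.
    have [] : (E `&` ~` G2) x.
      apply: Sx; split => //; split => // O2a.
      by have : (G1 `&` G2) a; [split => //; exact: PG1|rewrite G12].
    by move=> _; apply; exact: PG2.
  move=> B [b Bb] [C oC BC] [D clD BD].
  have clB : closed B by rewrite BD; exact: closedI.
  have clB' : closed (S `\` B).
    rewrite BC setDIr setDv set0U setDE; apply: closedI => //.
    exact: open_closedC.
  have BS : B `<=` S by rewrite BC => x [].
  have [Ba|nBa] := pselect (B a).
    have S0 : S `\` B = set0.
      by apply: (key B) => //; [rewrite setDIK|rewrite setDUK].
    apply/seteqP; split => // x Sx; apply: contrapT => nBx.
    by have : (S `\` B) x by []; rewrite S0.
  have B0 : B = set0.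
    apply: (key (S `\` B)) => //; last by rewrite setUC setDUK.
    by rewrite setIC setDIK.
  by move: Bb; rewrite B0.
(* If every such [E] met [Q], the quasi-component of [a] would be a connected subset of [L] meeting
   both [P] and [Q]. *)
have pt a : P a -> exists2 E, sep E /\ E a & E `&` Q = set0.
  move=> Pa; have La := PL _ Pa.
  have [| | | | |E sE EQ] := @compact_directed_closed X Q [set E | sep E /\ E a].
  - exact: cpt.
  - by exists L.
  - by move=> E [[clE _ _] _].
  - by move=> E F [sE Ea] [sF Fa]; exists (E `&` F) => //; split => //; exact: sepI.
  - move=> x Qx; apply: contrapT => H.
    apply: (noC _ a x (quasi a La)) => //.
      by move=> y; apply.
      by move=> E [].
    by move=> E [sE Ea]; apply: contrapT => nE; apply: H; exists E.
  by exists E.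
(* The same compactness argument over [P], applied to complements in [L] of relatively clopen sets
   missing [Q]; unions of such sets give directedness. *)
have [| | | | |E' [E [sE EQ] E'E] EP] := @compact_directed_closed X P
  [set E' | exists2 E, sep E /\ E `&` Q = set0 & E' = L `\` E].
- exact: cpt.
- exists L, set0; last by rewrite setD0.
  by rewrite set0I; split => //; split => //; [exact: closed0|rewrite setD0].
- by move=> _ [E [[_ clE' _] _] ->].
- move=> _ _ [E [sE EQ] ->] [F [sF FQ] ->].
  exists (L `\` (E `|` F)); last by move=> x [Lx /not_orP[]].
  exists (E `|` F) => //; split; last by rewrite setIUl EQ FQ setU0.
  have := sepD _ (sepI _ _ (sepD _ sE) (sepD _ sF)).
  by rewrite -setDUr setDD setIUr => -[]; case: sE => _ _ EL; case: sF => _ _ FL;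
    rewrite (setIidr EL) (setIidr FL).
- by move=> x /pt[E [sE Ex] EQ]; exists (L `\` E); [exists E|case].
have [clE clE' EL] := sE.
exists E; split => // x Px; apply: contrapT => nEx.
have : (E' `&` P) x by rewrite E'E; split => //; split => //; exact: PL.
by rewrite EP.
Qed.

(** [S] is the sum of the [g k] with weights 2^-(k+1), whose tails are bounded uniformly in [x]. All
    weights are positive, so a strict increase in a single term survives in the sum. *)
Lemma bounded_series (R : realType) (X : topologicalType) (g : nat -> X -> R) :
  (forall k x, 0 <= g k x <= 1) -> (forall k, continuous (g k)) ->
  exists S : X -> R, [/\ continuous S,
    forall x, (forall k, g k x = 0) -> S x = 0 &
    forall x y, (forall k, g k x <= g k y) ->
      S x <= S y /\ ((exists k, g k x < g k y) -> S x < S y)].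
Proof.
move=> g01 cg.
pose c k : R := 2^-1 ^+ k.+1.
have c0 k : 0 < c k by rewrite exprn_gt0// invr_gt0.
pose s n x := \sum_(0 <= k < n) c k * g k x.
have sS n x : s n.+1 x = s n x + c n * g n x by rewrite /s big_nat_recr.
have s_le m n x : (m <= n)%N -> s m x <= s n x <= s m x + 2 * (c m - c n).
  elim: n => [|n IH]; first by rewrite leqn0 => /eqP ->; lra.
  rewrite leq_eqVlt => /orP[/eqP->|]; first by lra.
  rewrite ltnS => /IH; rewrite sS.
  have /andP[g0 g1] := g01 n x; have := c0 n.
  have -> : c n.+1 = c n / 2 by rewrite /c exprSr.
  have := mulr_ge0 (ltW (c0 n)) g0; have := ler_piMr (ltW (c0 n)) g1.
  lra.
have ub m x : forall n, s n x <= s m x + 2 * c m.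
  move=> n; have [mn|/ltnW nm] := leqP m n.
    by have := s_le m n x mn; have := c0 n; lra.
  by have := s_le n m x nm; have := c0 m; lra.
pose S x := sup (range (s ^~ x)).
have hub x : has_ubound (range (s ^~ x)).
  by exists (s 0%N x + 2 * c 0%N) => _ [n _ <-]; exact: ub.
have hne x : range (s ^~ x) !=set0 by exists (s 0%N x), 0%N.
have sleS n x : s n x <= S x by apply: ub_le_sup => //; exists n.
have Sles n x : S x <= s n x + 2 * c n.
  by apply: ge_sup => // _ [m _ <-]; exact: ub.
have cs n : continuous (s n).
  elim: n => [|n IH] x.
    by have -> : s 0%N = cst 0; [apply/funext => y; rewrite /s big_geq|exact: cst_continuous].
  have -> : s n.+1 = s n + (fun x => c n * g n x) by apply/funext => y; rewrite sS.
  apply: cvgD; first exact: IH.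
  by apply: cvgMr; exact: cg.
exists S; split.
- move=> x; apply/cvgrPdist_le => e e0.
  have [n ne] : exists n, 2 * c n <= e / 3.
    have : 2 * c n @[n --> \oo] --> (2 * (2^-1 * 0) : R).
      apply: cvgMr; rewrite /c; under eq_fun do rewrite exprS.
      by apply: cvgMr; apply: cvg_expr; rewrite ger0_norm ?invf_lt1// ?ltr1n.
    rewrite !mulr0 => /cvgrPdist_le/(_ (e/3)); rewrite divr_gt0// => /(_ isT)[n _ /(_ n (leqnn n))].
    by rewrite sub0r normrN; exists n; apply: le_trans (ler_norm _) _.
  have /cvgrPdist_le/(_ (e / 3)) := @cs n x; rewrite divr_gt0// => /(_ isT) cx.
  near=> y.
  have : `|s n x - s n y| <= e / 3 by near: y.
  rewrite !ler_norml; have := Sles n x; have := Sles n y.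
  by have := sleS n x; have := sleS n y; lra.
- move=> x gx; apply/eqP; rewrite eq_le; apply/andP; split.
    apply: ge_sup => // _ [n _ <-]; rewrite /s big1// => k _.
    by rewrite gx mulr0.
  by apply: le_trans (sleS 0%N x); rewrite /s big_geq.
- move=> x y gxy.
  have sxy n : s n x <= s n y by apply: ler_sum => k _; rewrite ler_pM2l.
  split; first by apply: ge_sup => // _ [n _ <-]; exact: le_trans (sxy n) (sleS n y).
  move=> [k gk].
  pose d := c k * (g k y - g k x).
  have d0 : 0 < d by rewrite mulr_gt0// subr_gt0.
  have sd n : (k < n)%N -> s n x + d <= s n y.
    elim: n => // n IH; rewrite ltnS leq_eqVlt !sS => /orP[/eqP <-|/IH].
      by have := sxy k; rewrite /d; lra.
    have : c n * g n x <= c n * g n y by rewrite ler_pM2l.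
    lra.
  suff : S x <= S y - d by move: d0; lra.
  apply: ge_sup => // _ [n _ <-]; rewrite lerBrDr.
  apply: (le_trans _ (sleS (maxn k.+1 n) y)).
  have := sd (maxn k.+1 n); rewrite leq_maxl => /(_ isT).
  by have := s_le n (maxn k.+1 n) x (leq_maxr _ _); lra.
Unshelve. all: by end_near. Qed.

(** * Coordinates on the legs *)

(* [code x] names the leg of [x] by countably many bits and [mu x] is the height of
   [x] on that leg; the code of the top [v] carries no information. *)
Record leg_coordinates (R : realType) (T : topologicalType) (v : T)
    (mu : T -> R) (code : T -> nat -> bool) : Prop := LegCoordinates {
  height_continuous : continuous mu;
  height_ge0 : forall x, 0 <= mu x;
  height_eq0 : forall x, mu x = 0 <-> x = v;
  code_locally_constant : forall x n, x <> v ->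
    \forall y \near x, code y n = code x n;
  leg_inj : forall x y, x <> v -> y <> v -> code x =1 code y -> mu x = mu y ->
    x = y;
  leg_point : forall x s, 0 < s -> s <= mu x ->
    exists2 y, code y =1 code x & mu y = s }.

Definition tip (R : realType) (T : Type) (v : T) (mu : T -> R)
    (code : T -> nat -> bool) (e : T) :=
  e <> v /\ forall y, code y =1 code e -> mu y <= mu e.

Definition agree (T : Type) (code : T -> nat -> bool) n x y :=
  forall i, (i < n)%N -> code y i = code x i.

Section LegCoordinates.
Context {R : realType} {T : pseudoMetricType R}.
Context {v : T} {mu : T -> R} {code : T -> nat -> bool}.
Hypotheses (hT : hausdorff_space T) (cT : compact [set: T]).
Hypothesis HL : leg_coordinates v mu code.

Let mu_cont : continuous mu := height_continuous HL.
Let mu_ge0 := height_ge0 HL.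

Lemma height_top : mu v = 0. Proof. exact/(height_eq0 HL). Qed.

Lemma height_gt0 x : x <> v <-> 0 < mu x.
Proof.
rewrite lt_neqAle mu_ge0 andbT; split => [xv|].
  by apply/eqP => m0; apply: xv; apply/(height_eq0 HL).
by move=> /eqP m0 xv; apply: m0; rewrite xv height_top.
Qed.

Lemma closed_height_ge a : closed [set x | a <= mu x].
Proof.
apply: (@preimage_closed T R mu [set t | a <= t]); last exact: closed_ge.
by move=> x _; exact: mu_cont.
Qed.

Lemma closed_height_le a : closed [set x | mu x <= a].
Proof.
apply: (@preimage_closed T R mu [set t | t <= a]); last exact: closed_le.
by move=> x _; exact: mu_cont.
Qed.

(** The bound [a > 0] keeps limit points away from [v], where bits need not be locally constant. *)
Lemma closed_code a i b : 0 < a -> closed [set x | a <= mu x /\ code x i = b].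
Proof.
move=> a0 y cy.
have ay : a <= mu y.
  by apply: (@closed_height_ge a) => B By; have [z [[? ?] ?]] := cy B By; exists z.
have yv : y <> v by apply/height_gt0/(lt_le_trans a0).
have [z [[? <-] ->]] := cy _ (code_locally_constant HL i yv).
by [].
Qed.

Lemma agree_near n x : x <> v -> \forall y \near x, agree code n x y.
Proof.
move=> xv; elim: n => [|n IH]; first by apply: nearW.
have H := code_locally_constant HL n xv.
apply: filterS2 H IH => y Hy IHy i; rewrite ltnS leq_eqVlt.
by case/orP => [/eqP->//|]; exact: IHy.
Qed.

Lemma closed_agree n x a : 0 < a -> closed [set y | a <= mu y /\ agree code n x y].
Proof.
move=> a0 y cy.
have ay : a <= mu y.
  by apply: (@closed_height_ge a) => B By; have [z [[? ?] ?]] := cy B By; exists z.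
split => // i ni.
suff [] : [set z | a <= mu z /\ code z i = code x i] y by [].
apply: closed_code => // B By; have [z [[? az] ?]] := cy B By.
by exists z; split => //; split => //; exact: az.
Qed.

Lemma off_top_near x : x <> v -> \forall y \near x, y <> v.
Proof.
move=> /height_gt0 x0; near=> y; apply/height_gt0; near: y.
by apply: (@mu_cont x [set t | 0 < t]); exact: lt_nbhsr.
Unshelve. all: by end_near. Qed.

(** By compactness it is enough that [z] is the only cluster point. Bounds on the height and values
    of single bits are closed conditions, so a cluster point has the height and the code of [z]. *)
Lemma cvg_leg (I : Type) (F : set_system I) {FF : ProperFilter F} (g : I -> T) z :
  z <> v -> mu (g t) @[t --> F] --> mu z ->
  (forall i, \forall t \near F, code (g t) i = code z i) ->
  g @ F --> z.
Proof.
move=> zv cm cc.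
have sub : cluster (g @ F) `<=` [set z].
  move=> y cy /=.
  have my : mu y = mu z.
    apply/eqP; rewrite eq_le; apply/andP; split.
      apply/ler_addgt0Pr => e e0.
      apply: (cluster_closed (@closed_height_le (mu z + e)) _ cy).
      rewrite /= nbhs_filterE; near=> t => /=; rewrite ltW//; near: t.
      by apply: (cm [set x | x < mu z + e]); apply: lt_nbhsl; rewrite ltrDl.
    apply/ler_addgt0Pr => e e0; rewrite -lerBlDr.
    apply: (cluster_closed (@closed_height_ge (mu z - e)) _ cy).
    rewrite /= nbhs_filterE; near=> t => /=; rewrite ltW//; near: t.
    by apply: (cm [set x | mu z - e < x]); apply: lt_nbhsr; rewrite ltrBlDr ltrDl.
  have mz : 0 < mu z by exact/height_gt0.
  apply: (leg_inj HL) => //; first by apply/height_gt0; rewrite my.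
  move=> i; have mz2 : 0 < mu z / 2 by rewrite divr_gt0.
  apply: (cluster_closed (@closed_code (mu z / 2) i (code z i) _) _ cy).2 => //.
  rewrite /= nbhs_filterE; near=> t; split => /=; last by near: t.
  rewrite ltW//; near: t; apply: (cm [set x | mu z / 2 < x]); apply: lt_nbhsr.
  by rewrite ltr_pdivrMr// ltr_pMr// ltr1n.
have [|y [_ cy]] := cT (_ : ProperFilter (g @ F)); first exact: filterT.
apply: (@compact_cluster_set1 _ z (g @ F) setT) => //; try exact: filterT.
apply/seteqP; split => // x ->; by move: (sub _ cy) (cy) => /= ->.
Unshelve. all: by end_near. Qed.

Lemma cvg_top (I : Type) (F : set_system I) {FF : ProperFilter F} (g : I -> T) :
  mu (g t) @[t --> F] --> (0 : R) -> g @ F --> v.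
Proof.
move=> cm.
have sub : cluster (g @ F) `<=` [set v].
  move=> y cy /=; apply/(height_eq0 HL)/eqP; rewrite eq_le mu_ge0 andbT.
  apply/ler_addgt0Pr => e e0.
  apply: (cluster_closed (@closed_height_le (0 + e)) _ cy).
  rewrite /= nbhs_filterE; near=> t => /=; rewrite ltW//; near: t.
  by apply: (cm [set x | x < 0 + e]); apply: lt_nbhsl; rewrite ltrDl.
have [|y [_ cy]] := cT (_ : ProperFilter (g @ F)); first exact: filterT.
apply: (@compact_cluster_set1 _ v (g @ F) setT) => //; try exact: filterT.
apply/seteqP; split => // x ->; by move: (sub _ cy) (cy) => /= ->.
Unshelve. all: by end_near. Qed.

(** Total in [s] so that choice yields a function. Height 0 is reached only at [v], whose code is
    arbitrary, hence the guard [0 < s]. *)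
Lemma leg_pt_ex x s : exists y, 0 <= s <= mu x ->
  [/\ mu y = s & 0 < s -> code y =1 code x].
Proof.
have [/andP[s0 sx]|] := pselect (is_true (0 <= s <= mu x)); last by exists v.
have [s_gt0|s_le0] := ltP 0 s.
  by have [y cy my] := leg_point HL s_gt0 sx; exists y.
exists v => _; split => //.
by rewrite height_top; apply/eqP; rewrite eq_le s0 s_le0.
Qed.

Definition leg_pt x s := sval (cid (leg_pt_ex x s)).

Lemma mu_leg_pt x s : 0 <= s <= mu x -> mu (leg_pt x s) = s.
Proof. by rewrite /leg_pt; case: cid => y /= H /H []. Qed.

Lemma code_leg_pt x s : 0 < s <= mu x -> code (leg_pt x s) =1 code x.
Proof.
rewrite /leg_pt; case: cid => y /= H /andP[s0 sx].
by case: H; rewrite ?(ltW s0)// => _; apply.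
Qed.

Lemma leg_pt_off_top x s : 0 < s <= mu x -> leg_pt x s <> v.
Proof.
move=> /andP[s0 sx]; apply/height_gt0.
by rewrite mu_leg_pt // ?(ltW s0).
Qed.

Lemma leg_pt_cvg (I : Type) (F : set_system I) {FF : ProperFilter F} x
    (s : I -> R) s0 :
  0 < s0 <= mu x -> (\forall t \near F, s t <= mu x) -> s @ F --> s0 ->
  leg_pt x (s t) @[t --> F] --> leg_pt x s0.
Proof.
move=> s0x sx ss0.
have sp : \forall t \near F, 0 < s t.
  by apply: (ss0 [set x | 0 < x]); apply: lt_nbhsr; case/andP: s0x.
apply: cvg_leg; first exact: leg_pt_off_top.
  rewrite mu_leg_pt; last by case/andP: s0x => /ltW -> ->.
  apply: cvg_trans ss0; apply: near_eq_cvg; near=> t.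
  by rewrite mu_leg_pt// (ltW (near sp t _))//=; near: t.
by move=> i; near=> t; rewrite !code_leg_pt// (near sp t _)//=; near: t.
Unshelve. all: by end_near. Qed.

(** The preimage of a closed set under the inverse is its image under [f], which is compact and
    hence closed. *)
Lemma continuous_inj_embedding (f : T -> T) :
  continuous f -> injective f -> embedding f.
Proof.
move=> cf fi; split=> //.
have /choice[g gP] : forall y, exists x, range f y -> f x = y.
  by move=> y; have [[x _ <-]|n] := pselect (range f y); [exists x|exists v].
exists g; split; last by move=> x; apply: fi; apply: gP; exists x.
apply/continuous_closedP => C cC; apply/closed_subspaceP.
exists (f @` C).
  apply: compact_closed => //; apply: continuous_compact.
    exact: continuous_subspaceT.
  by apply: subclosed_compact cT _.
apply/seteqP; split => y [/= hy ry]; split => //.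
  case: hy => x Cx xy; have gx : g y = x by apply: fi; rewrite gP.
  by move: Cx; rewrite -gx.
by exists (g y) => //; apply: gP.
Qed.

End LegCoordinates.

(** * A copy without a retraction *)

Section Halving.
Context {R : realType} {T : pseudoMetricType R}.
Context {v : T} {mu : T -> R} {code : T -> nat -> bool}.
Hypotheses (hT : hausdorff_space T) (cT : compact [set: T]).
Hypothesis HL : leg_coordinates v mu code.
Hypothesis tip_dense : forall x O, x <> v -> nbhs x O ->
  exists2 e, O e & tip v mu code e.

Let mu_cont : continuous mu := height_continuous HL.
Let mu_ge0 := height_ge0 HL.

Definition halve x := leg_pt HL x (mu x / 2).

Lemma mu_halve x : mu (halve x) = mu x / 2.
Proof. by rewrite mu_leg_pt//; have := mu_ge0 x; lra. Qed.

Lemma code_halve x : x <> v -> code (halve x) =1 code x.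
Proof. by move=> /(height_gt0 HL) x0; apply: code_leg_pt; lra. Qed.

Lemma halve_off_top x : x <> v -> halve x <> v.
Proof. by move=> /(height_gt0 HL) x0; apply: leg_pt_off_top; lra. Qed.

Lemma halve_inj : injective halve.
Proof.
move=> x y xy.
have mxy : mu x = mu y.
  by have := congr1 mu xy; rewrite !mu_halve; lra.
have [xv|xv] := pselect (x = v).
  by move: mxy; rewrite xv (height_top HL) => /esym/(height_eq0 HL).
have yv : y <> v by apply/(height_gt0 HL); rewrite -mxy; exact/(height_gt0 HL).
apply: (leg_inj HL) => // i.
by rewrite -(code_halve xv) xy code_halve.
Qed.

Lemma halve_continuous : continuous halve.
Proof.
move=> x; rewrite /continuous_at.
have cm : mu (halve t) @[t --> x] --> mu x / 2.
  under eq_fun do rewrite mu_halve.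
  by apply: cvgMl; exact: mu_cont.
have [xv|xv] := pselect (x = v).
  have -> : halve x = v.
    by apply/(height_eq0 HL); rewrite mu_halve xv (height_top HL) mul0r.
  by apply: (cvg_top hT cT HL); move: cm; rewrite {2}xv (height_top HL) mul0r.
apply: (cvg_leg hT cT HL); first exact: halve_off_top.
  by rewrite mu_halve.
move=> i; have cx := code_locally_constant HL i xv.
have vx := off_top_near HL xv.
near=> t; rewrite !code_halve//; by near: t.
Unshelve. all: by end_near. Qed.

Lemma halve_embedding : embedding halve.
Proof.
exact: (@continuous_inj_embedding _ _ v hT cT _ halve_continuous halve_inj).
Qed.

(** Bits are locally constant off [v], so a path can change legs only through [v]. *)
Lemma leg_path_constant (g : R -> T) (a b : R) : a <= b ->
  {within `[a, b], continuous g} -> (forall t, a <= t <= b -> g t <> v) ->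
  code (g b) =1 code (g a).
Proof.
move=> ab cg gv i.
have cC : connected (g @` `[a, b]).
  by apply: connected_continuous_connected => //; exact: segment_connected.
have [Ca Cb] : (g @` `[a, b]) (g a) /\ (g @` `[a, b]) (g b).
  by split; [exists a|exists b] => //=; rewrite in_itv /= lexx ab.
apply: (@connected_locally_constant _ _ (fun y => code y i = code (g a) i)
  _ _ cC _ Ca Cb) => // _ [t + <-]; rewrite /= in_itv /= => /gv gtv.
by apply: filterS (code_locally_constant HL i gtv) => u ->.
Qed.

Lemma halve_no_retraction : (exists x, x <> v) -> ~ admits_retraction halve.
Proof.
move=> [x0 x0v] [r [cr rr rid]].
pose z0 := halve x0; pose s := mu z0.
have z0v : z0 <> v by exact: halve_off_top.
have s0 : 0 < s by exact/(height_gt0 HL).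
have rz0 : r z0 = z0 by apply: rid; exists x0.
have key n : exists z, [/\ agree code n z0 z, s / 4 <= mu z,
    mu z <= s + s / n.+1%:R & r z = v].
  have O1 : \forall y \near z0, agree code n z0 y by exact: (agree_near HL).
  have n0 : 0 < s / n.+1%:R :> R by rewrite divr_gt0// ltr0n.
  have O2 : \forall y \near z0, mu y < s + s / n.+1%:R.
    apply: (@mu_cont z0 [set t | t < s + s / n.+1%:R]); apply: lt_nbhsl.
    by rewrite ltrDl.
  have O3 : \forall y \near z0, mu y < 5 * s / 4.
    apply: (@mu_cont z0 [set t | t < 5 * s / 4]); apply: lt_nbhsl.
    by rewrite /= -/s; lra.
  have O4 : \forall y \near z0, s / 2 < mu y.
    apply: (@mu_cont z0 [set t | s / 2 < t]); apply: lt_nbhsr.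
    by rewrite /= -/s; lra.
  have O5 : \forall y \near z0, 3 * s / 4 < mu (r y).
    have cmr : mu (r y) @[y --> z0] --> s.
      rewrite /s -{2}rz0; apply: (@continuous_comp _ _ _ r mu z0); first exact: cr.
      exact: mu_cont.
    by apply: (cmr [set t | 3 * s / 4 < t]); apply: lt_nbhsr; lra.
  have [e [e1 [e2 [e3 [e4 e5]]]] [ev et]] := tip_dense z0v
    (filterI O1 (filterI O2 (filterI O3 (filterI O4 O5)))).
  move: e2 e3 e4 e5 => /= e2 e3 e4 e5.
  have e0 : 0 < mu e by exact/(height_gt0 HL).
  pose g t := leg_pt HL e t.
  have cg : {within `[mu e / 2, mu e], continuous g}.
    apply/subspace_continuousP => t tI.
    have PF : ProperFilter (within `[mu e / 2, mu e]%classic (nbhs t)).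
      by apply: within_nbhs_proper; exact: subset_closure.
    move: tI; rewrite /= in_itv /= => /andP[t1 t2].
    have tt : 0 < t <= mu e by lra.
    apply: (cvg_leg hT cT HL); first exact: leg_pt_off_top.
      have gid : \forall u \near within `[mu e / 2, mu e]%classic (nbhs t),
          u = mu (g u).
        apply: (@filterE _ (nbhs t)) => u /=; rewrite in_itv /= => /andP[u1 u2].
        by rewrite mu_leg_pt//; lra.
      rewrite mu_leg_pt; last lra.
      apply: cvg_trans; first by apply: near_eq_cvg; exact: gid.
      exact: cvg_within.
    move=> i; apply: (@filterE _ (nbhs t)) => u /=.
    rewrite in_itv /= => /andP[u1 u2].
    by rewrite !code_leg_pt//; lra.
  (* If [r] avoided [v] on the segment from [halve e] to [e], then [r e] would lie on the leg of [e]
     and be [halve y] with [y] no higher than the tip [e]. Its height would be below half of 5s/4,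
     yet it exceeds 3s/4. *)
  apply: contrapT => none.
  have rgv t : mu e / 2 <= t <= mu e -> r (g t) <> v.
    move=> /andP[t1 t2] rv; apply: none; exists (g t).
    have tt : 0 < t <= mu e by lra.
    split => //.
    - by move=> i /e1 <-; rewrite code_leg_pt.
    - by rewrite mu_leg_pt//; lra.
    - by rewrite mu_leg_pt; [exact: le_trans t2 (ltW e2)|lra].
  have := @leg_path_constant (r \o g) (mu e / 2) (mu e).
  have e2e : mu e / 2 <= mu e by lra.
  have crg : {within `[mu e / 2, mu e], continuous (r \o g)}.
    apply/subspace_continuousP => t tI.
    have /subspace_continuousP/(_ t tI) cgt := cg.
    exact: cvg_comp cgt (cr _).
  move=> /(_ e2e crg rgv) /=.
  have -> : g (mu e) = e.
    apply: (leg_inj HL) => //; first by apply: leg_pt_off_top; lra.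
      by apply: code_leg_pt; lra.
    by rewrite mu_leg_pt//; lra.
  have -> : r (g (mu e / 2)) = halve e by apply: rid; exists e.
  move=> ce; have [y _ ye] := rr e.
  have yv : y <> v.
    move=> yv; move: e5 => /=; rewrite -ye mu_halve yv (height_top HL); lra.
  have : mu y <= mu e.
    by apply: et => i; rewrite -(code_halve yv) ye ce code_halve.
  by move: e5 => /=; rewrite -ye mu_halve; move: e3 => /=; lra.
have /choice[z zP] := key.
have [y yP] := compact_seq_cluster z cT.
have s4 : 0 < s / 4 by lra.
have yge : s / 4 <= mu y.
  apply: (yP [set x | s / 4 <= mu x] (@closed_height_ge _ _ _ _ _ HL _)).
  by apply: nearW => n; case: (zP n).
have yle : mu y <= s.
  apply/ler_addgt0Pr => e e_gt0.
  apply: (yP [set x | mu x <= s + e] (@closed_height_le _ _ _ _ _ HL _)).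
  have [N NP] : exists N : nat, s / e < N%:R.
    by exists (Num.truncn (s / e)).+1; exact: truncnS_gt.
  near=> n => /=.
  have [_ _ /le_trans -> //] := zP n.
  rewrite lerD2l ler_pdivrMr ?ltr0n// mulrC -ler_pdivrMr//.
  apply/ltW/(lt_le_trans NP); rewrite ler_nat.
  by apply: leqW; near: n; exact: nbhs_infty_ge.
have yc : code y =1 code z0.
  move=> i; suff [_] : [set y | s / 4 <= mu y /\ agree code i.+1 z0 y] y by apply.
  apply: (yP _ (@closed_agree _ _ _ _ _ HL i.+1 z0 _ s4)).
  near=> n; split; first by case: (zP n).
  have [az _ _ _] := zP n => j ji; apply: az; apply: leq_trans ji _.
  by near: n; exact: nbhs_infty_gt.
have ry : r y = v.
  apply: (yP [set x | r x = v]); last by apply: nearW => n; case: (zP n).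
  apply: (@preimage_closed T T r [set v]); first by move=> x _; exact: cr.
  exact: (compact_closed hT (@compact_set1 _ v)).
have y0 : 0 < mu y by exact: lt_le_trans yge.
have yv : y <> v by exact/(height_gt0 HL).
have sx : s = mu x0 / 2 by rewrite /s mu_halve.
(* The limit [y] lies on the leg of [z0], no higher than [z0], so it is the half of the point of
   height [2 * mu y] on the leg of [x0]; thus [r] fixes it although [r y = v]. *)
have yr : range halve y.
  exists (leg_pt HL x0 (2 * mu y)) => //.
  have yx : 0 < 2 * mu y <= mu x0 by lra.
  have lv : leg_pt HL x0 (2 * mu y) <> v by exact: leg_pt_off_top.
  apply: (leg_inj HL) => //; first exact: halve_off_top.
    by move=> i; rewrite code_halve// code_leg_pt// yc code_halve.
  by rewrite mu_halve mu_leg_pt//; lra.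
by apply: yv; rewrite -ry rid.
Unshelve. all: by end_near. Qed.

End Halving.

(** * A proper copy with a retraction *)

Section SelfEmbedding.
Context {R : realType} {T : pseudoMetricType R}.
Context {v : T} {mu : T -> R} {code : T -> nat -> bool}.
Hypotheses (hT : hausdorff_space T) (cT : compact [set: T]).
Hypothesis HL : leg_coordinates v mu code.
Hypothesis tip_dense : forall x O, x <> v -> nbhs x O ->
  exists2 e, O e & tip v mu code e.
Hypothesis off_top : exists x, x <> v.

Let mu_cont : continuous mu := height_continuous HL.
Let mu_ge0 := height_ge0 HL.

(** * Words, cylinders and boxes of codes *)

Local Notation agree := (agree code).

(* Words list the most recent bit first. *)
Fixpoint word (c : nat -> bool) n : seq bool :=
  if n is m.+1 then c m :: word c m else [::].

Lemma size_word c n : size (word c n) = n.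
Proof. by elim: n => //= n ->. Qed.

Lemma word_eqP c c' n : word c n = word c' n <-> forall i, (i < n)%N -> c i = c' i.
Proof.
elim: n => [|n IH] /=; first by split.
split => [[cn /IH H] i|H].
  by rewrite ltnS leq_eqVlt => /orP[/eqP->//|]; exact: H.
by rewrite (H n)//; congr cons; apply/IH => i /ltnW ni; exact: H.
Qed.

Definition cyl w x := x <> v /\ word (code x) (size w) = w.

Definition inhabited w := exists x, cyl w x.

(** A target carries a reference point together with a number of bits; in a [good] target this point
    is a highest one of the box. *)
Definition box (t : T * nat) x := x <> v /\ agree t.2 t.1 x.

Lemma cyl_cons b w x : cyl (b :: w) x -> cyl w x.
Proof. by move=> [xv [_ xw]]; split. Qed.

Lemma inhabited_cons b w : inhabited (b :: w) -> inhabited w.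
Proof. by move=> [x /cyl_cons wx]; exists x. Qed.

Lemma cyl_word x n : x <> v -> cyl (word (code x) n) x.
Proof. by move=> xv; split => //; rewrite size_word. Qed.

Lemma cyl_agree w x y : cyl w x -> y <> v -> cyl w y <-> agree (size w) x y.
Proof.
move=> [xv xw] yv; split => [[_ yw] i iw|xy].
  by apply: (word_eqP _ _ _).1 iw; rewrite yw xw.
by split => //; rewrite -[RHS]xw; apply/word_eqP.
Qed.

(** Only points at least as high as [e] compete, and these form a closed set away from [v], hence a
    compact one. *)
Lemma box_max e N : e <> v ->
  exists2 m, box (e, N) m & forall x, box (e, N) x -> mu x <= mu m.
Proof.
move=> ev; have e0 : 0 < mu e by exact/(height_gt0 HL).
have clK := @closed_agree _ _ _ _ _ HL N e _ e0.
have [||m] := @compact_EVT_max T R mu _ _ (subclosed_compact clK cT (@subsetT _ _)).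
- by exists e; split => // i.
- exact: continuous_subspaceT.
rewrite inE => -[em am] mmax; exists m.
  by split => //; apply/(height_gt0 HL); exact: lt_le_trans em.
move=> x [xv ax]; have [ex|/ltW xe] := leP (mu e) (mu x).
  by apply: mmax; rewrite inE.
exact: le_trans em.
Qed.

Lemma longest_ex : exists c : seq bool -> T, forall w, inhabited w ->
  cyl w (c w) /\ forall x, cyl w x -> mu x <= mu (c w).
Proof.
suff /choice[c cP] : forall w, exists c, inhabited w ->
    cyl w c /\ forall x, cyl w x -> mu x <= mu c by exists c.
move=> w.
have [[x wx]|] := pselect (inhabited w); last by exists v.
have [m [mv xm] mmax] := @box_max x (size w) wx.1.
exists m => _; split; first exact/(cyl_agree wx).
by move=> y wy; apply: mmax; split; [exact: wy.1|apply/(cyl_agree wx wy.1)].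
Qed.

Definition longest := sval (cid longest_ex).

Lemma cyl_longest w : inhabited w -> cyl w (longest w).
Proof. by rewrite /longest; case: cid => c /= H /H []. Qed.

Lemma longest_max w x : cyl w x -> mu x <= mu (longest w).
Proof.
rewrite /longest; case: cid => c /= H wx.
by have [|_] := H w; [exists x|exact].
Qed.

Lemma longest_gt0 w : inhabited w -> 0 < mu (longest w).
Proof. by move=> /cyl_longest[/(height_gt0 HL)]. Qed.

(** Each point on the leg of [t.1] is a limit of tips, so legs in the box end near any height below
    that of [t.1]. Excluding the height [q] lets a second tip be chosen on another leg. *)
Lemma pick_tip (t : T * nat) lo hi q : t.1 <> v -> 0 < lo -> lo < hi -> lo < mu t.1 ->
  exists e, [/\ tip v mu code e, box t e, lo < mu e < hi & mu e <> q].
Proof.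
move=> tv lo0 lohi lot.
have [s [slo shi st sq]] : exists s, [/\ lo < s, s < hi, s <= mu t.1 & s <> q].
  pose d := Num.min hi (mu t.1).
  have [dhi dt] : d <= hi /\ d <= mu t.1 by rewrite /d !ge_min !lexx orbT.
  have lod : lo < d by rewrite /d lt_min lohi.
  have [->|/eqP nq] := eqVneq q ((lo + d) / 2).
    by exists ((2 * lo + d) / 3); split; lra.
  by exists ((lo + d) / 2); split; [lra|lra|lra|apply/nesym].
have s_pos : 0 < s <= mu t.1 by lra.
pose y := leg_pt HL t.1 s.
have my : mu y = s by rewrite mu_leg_pt//; lra.
have yv : y <> v by exact: leg_pt_off_top.
have O1 := agree_near HL t.2 yv.
have O2 : \forall z \near y, lo < mu z.
  by apply: (@mu_cont y [set t | lo < t]); apply: lt_nbhsr; rewrite my.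
have O3 : \forall z \near y, mu z < hi.
  by apply: (@mu_cont y [set t | t < hi]); apply: lt_nbhsl; rewrite my.
have O4 : \forall z \near y, mu z != q.
  apply: (@mu_cont y [set t | t != q]); apply: open_nbhs_nbhs.
  by split; [exact: open_neq|rewrite /= my; apply/eqP].
have [e [/= e1 [/= e2 [/= e3 /= e4]]] et] :=
  tip_dense yv (filterI O1 (filterI O2 (filterI O3 O4))).
exists e; split => //; last by apply/eqP.
  by split; [exact: et.1|move=> i it; rewrite e1// code_leg_pt].
by rewrite e2.
Qed.

(** Upper semicontinuity of the leg length: points of height at least [hi] in ever smaller boxes
    would cluster at a point of the leg of [e] above its tip. *)
Lemma tip_narrow e hi : tip v mu code e -> mu e < hi ->
  exists N, forall M, (N <= M)%N -> forall x, box (e, M) x -> mu x < hi.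
Proof.
move=> [ev et] ehi.
have e0 : 0 < mu e by exact/(height_gt0 HL).
suff [N NP] : exists N, forall x, box (e, N) x -> mu x < hi.
  exists N => M NM x [xv ax]; apply: NP; split => // i iN; apply: ax.
  exact: leq_trans iN NM.
apply: contrapT => /forallNP none.
have /choice[x xP] : forall N, exists x, box (e, N) x /\ hi <= mu x.
  move=> N; have /existsNP[x /not_implyP[bx /negP]] := none N.
  by rewrite -leNgt => hx; exists x.
have [y yP] := compact_seq_cluster x cT.
have hi0 : 0 < hi by exact: lt_trans ehi.
have yge : hi <= mu y.
  apply: (yP [set x | hi <= mu x] (@closed_height_ge _ _ _ _ _ HL _)).
  by apply: nearW => n; case: (xP n).
have : mu y <= mu e.
  apply: et => i.
  suff [_] : [set y | hi <= mu y /\ agree i.+1 e y] y by apply.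
  apply: (yP _ (@closed_agree _ _ _ _ _ HL i.+1 e _ hi0)).
  near=> n; have [[_ ax] hx] := xP n; split => // j ji; apply: ax.
  by apply: leq_trans ji _; near: n; exact: nbhs_infty_gt.
by move=> /(le_trans yge)/(lt_le_trans ehi); rewrite ltxx.
Unshelve. all: by end_near. Qed.

(** * The tree of targets *)

Let eps n : R := 2^-1 ^+ n.

Lemma eps_gt0 n : 0 < eps n. Proof. by rewrite exprn_gt0// invr_gt0. Qed.

Lemma eps_le m n : (m <= n)%N -> eps n <= eps m.
Proof. by move=> mn; apply: ler_wiXn2l; rewrite ?invr_ge0 ?invf_le1 ?ler1n. Qed.

(* The box [t] is a target for the cylinder [w] scaled by 1/2: the longest leg in
   the box exceeds half of the longest leg of the cylinder by a factor which
   tends to 1 with the length of [w], so that no error survives in the limit. *)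
Definition good w (t : T * nat) :=
  [/\ t.1 <> v, forall x, box t x -> mu x <= mu t.1, (size w <= t.2)%N,
      mu (longest w) < 2 * mu t.1 &
      2 * mu t.1 <= (1 + eps (size w)) * mu (longest w)].

(** For each child a tip is chosen in the box with height between the two bounds of [good]. The tips
    lie on different legs, so boxes with enough bits around them are disjoint and, by [tip_narrow],
    respect the upper bound. *)
Lemma good_split w t : inhabited w -> good w t ->
  exists t' : bool -> T * nat,
    (forall b, inhabited (b :: w) -> good (b :: w) (t' b)) /\
    (forall b, box (t' b) `<=` box t) /\
    (forall x, box (t' false) x -> ~ box (t' true) x).
Proof.
move=> iw [tv tmax wt tlo thi].
(* A child that is not inhabited inherits the length of [w], so that tips are picked uniformly for
   both bits. *)
pose h b := if pselect (inhabited (b :: w)) then mu (longest (b :: w))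
            else mu (longest w).
have h0 b : 0 < h b by rewrite /h; case: pselect => *; exact: longest_gt0.
have ht b : h b < 2 * mu t.1.
  apply: le_lt_trans tlo; rewrite /h; case: pselect => // ib.
  by apply: longest_max; apply: cyl_cons; exact: (cyl_longest ib).
pose hi b := (1 + eps (size w).+1) * h b / 2.
have e0 := eps_gt0 (size w).+1.
have hhi b : h b / 2 < hi b.
  by rewrite /hi ltr_pM2r ?invr_gt0// ltr_pMl// ltrDl.
have tip_b b q : exists e, [/\ tip v mu code e, box t e, h b / 2 < mu e < hi b & mu e <> q].
  by apply: pick_tip => //; have := ht b; have := h0 b; lra.
have [e0' [tip0 be0 /andP[lo0 hi0] _]] := tip_b false 0.
have [e1' [tip1 be1 /andP[lo1 hi1] e01]] := tip_b true (mu e0').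
have [i ci] : exists i, code e0' i <> code e1' i.
  apply: contrapT => /forallNP H; apply: e01.
  have {}H : code e0' =1 code e1' by move=> i; exact: contrapT (H i).
  apply/eqP; rewrite eq_le; apply/andP; split; last exact: tip1.2.
  by apply: tip0.2 => i; rewrite H.
have [N0 N0P] := tip_narrow tip0 hi0.
have [N1 N1P] := tip_narrow tip1 hi1.
(* [N0] and [N1] bound the heights, bit [i] separates the boxes, [size w] meets the bit count of
   [good] for the children, and [t.2] nests them in the box of [t]. *)
pose N := maxn (maxn N0 N1) (maxn i.+1 (maxn (size w).+1 t.2)).
have [m0 [m0v am0] mm0] := @box_max e0' N tip0.1.
have [m1 [m1v am1] mm1] := @box_max e1' N tip1.1.
(* Reference points are moved from the tips to highest points; by [boxm] the boxes stay the same. *)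
pose e' b := if b then e1' else e0'; pose m b := if b then m1 else m0.
have boxm b x : box (m b, N) x <-> box (e' b, N) x.
  have am : agree N (e' b) (m b) by case: b.
  by split => -[xv ax]; split => // j jN; rewrite ax//= am.
have eb b : [/\ tip v mu code (e' b), box t (e' b), h b / 2 < mu (e' b)
    & forall x, box (e' b, N) x -> mu x < hi b].
  case: b => /=; split => //; [apply: N1P|apply: N0P]; rewrite /N.
    by apply: leq_trans (leq_maxl _ _); exact: leq_maxr.
  by apply: leq_trans (leq_maxl _ _); exact: leq_maxl.
have [iN wN tN] : [/\ (i < N)%N, (size w < N)%N & (t.2 <= N)%N].
  by rewrite /N !leq_max !leqnn !orbT.
exists (fun b => (m b, N)); split; last first.
  split => [b x /boxm[xv ax]|x /boxm[_ /(_ _ iN) + ] /boxm[_ /(_ _ iN)]].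
    split => // j jt; rewrite ax/=; last exact: leq_trans jt tN.
    by have [_ [_ /(_ _ jt)]] := eb b.
  by move=> /= -> /ci.
move=> b ib; have [[tv' _] _ lo hib] := eb b.
have hE : h b = mu (longest (b :: w)) by rewrite /h; case: pselect.
have mmax x : box (e' b, N) x -> mu x <= mu (m b) by case: (b); auto.
have bm : box (e' b, N) (m b) by case: (b).
split => //.
- by case: (b).
- by move=> x /boxm; exact: mmax.
- rewrite -hE.
  have : mu (e' b) <= mu (m b) by apply: mmax; split.
  by move=> /=; lra.
- rewrite -hE; have := hib _ bm; rewrite /hi /=; lra.
Qed.

Lemma target_ex : exists tgt : seq bool -> T * nat,
  [/\ forall w, inhabited w -> good w (tgt w),
      forall x, x <> v -> box (tgt [::]) x,
      forall b w, inhabited w -> box (tgt (b :: w)) `<=` box (tgt w) &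
      forall w x, inhabited w ->
        box (tgt (false :: w)) x -> ~ box (tgt (true :: w)) x].
Proof.
have [x0 x0v] := off_top.
have i0 : inhabited [::] by exists x0.
have /choice[step stepP] : forall wt : seq bool * (T * nat), exists t' : bool -> T * nat,
    inhabited wt.1 -> good wt.1 wt.2 ->
    (forall b, inhabited (b :: wt.1) -> good (b :: wt.1) (t' b)) /\
    (forall b, box (t' b) `<=` box wt.2) /\
    (forall x, box (t' false) x -> ~ box (t' true) x).
  move=> [w t] /=; have [[iw gw]|nn] := pselect (inhabited w /\ good w t).
    by have [t' t'P] := good_split iw gw; exists t'.
  by exists (fun _ => t) => iw gw; exfalso; apply: nn.
(* At the root no bit is fixed and [eps 0 = 1], so the upper bound of [good] holds with equality. *)
pose fix tgt w := if w is b :: w' then step (w', tgt w') b else (longest [::], 0%N).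
have tgood : forall w, inhabited w -> good w (tgt w).
  elim=> [_|b w IH ib]; last first.
    have iw := inhabited_cons ib.
    by have [H _] := stepP (w, tgt w) iw (IH iw); exact: H.
  have l0 := longest_gt0 i0.
  split => //=.
  - by have [] := cyl_longest i0.
  - by move=> x [xv _]; apply: longest_max.
  - by lra.
exists tgt; split => //.
- by move=> b w iw; have [_ [H _]] := stepP (w, tgt w) iw (tgood _ iw); exact: H.
- by move=> w x iw; have [_ [_ H]] := stepP (w, tgt w) iw (tgood _ iw); exact: H.
Qed.

Definition target := sval (cid target_ex).

Lemma target_good w : inhabited w -> good w (target w).
Proof. by rewrite /target; case: cid => t [/= H _ _ _]; exact: H. Qed.

Lemma target_root x : x <> v -> box (target [::]) x.
Proof. by rewrite /target; case: cid => t [/= _ H _ _]; exact: H. Qed.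

Lemma target_cons b w : inhabited w -> box (target (b :: w)) `<=` box (target w).
Proof. by rewrite /target; case: cid => t [/= _ _ H _]; exact: H. Qed.

Lemma target_disjoint w x : inhabited w ->
  box (target (false :: w)) x -> ~ box (target (true :: w)) x.
Proof. by rewrite /target; case: cid => t [/= _ _ _ H]; exact: H. Qed.

Lemma target_inj w w' x : size w = size w' -> inhabited w -> inhabited w' ->
  box (target w) x -> box (target w') x -> w = w'.
Proof.
elim: w w' => [[]//|b w IH [//|b' w'] [sw] ib ib' bx bx'].
have iw := inhabited_cons ib; have iw' := inhabited_cons ib'.
have ww : w = w' by apply: IH => //; [apply: target_cons bx|apply: target_cons bx'].
rewrite -ww in bx' *; congr cons.
by case: b b' bx bx' {ib ib'} => [] [] // bx bx'; have := @target_disjoint w x iw; tauto.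
Qed.

Lemma target_sub w w' x : (size w <= size w')%N -> inhabited w -> inhabited w' ->
  box (target w) x -> box (target w') x -> box (target w') `<=` box (target w).
Proof.
move=> + iw; elim: w' => [|b w' IH] /=.
  by rewrite leqn0 size_eq0 => /eqP -> _ _ _ y.
rewrite leq_eqVlt => /orP[/eqP sw ib bw bw'|]; first by rewrite (@target_inj w (b :: w') x).
rewrite ltnS => sw ib bw bw'; have iw' := inhabited_cons ib.
apply: subset_trans (target_cons iw') _.
by apply: IH => //; exact: target_cons bw'.
Qed.

Lemma target_word_sub x m n : x <> v -> (m <= n)%N ->
  box (target (word (code x) n)) `<=` box (target (word (code x) m)).
Proof.
move=> xv; elim: n => [|n IH]; first by rewrite leqn0 => /eqP ->.
rewrite leq_eqVlt => /orP[/eqP->//|]; rewrite ltnS => /IH; apply: subset_trans => /=.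
by apply: target_cons; exists x; exact: cyl_word.
Qed.

Lemma inhabited_word x n : x <> v -> inhabited (word (code x) n).
Proof. by move=> xv; exists x; exact: cyl_word. Qed.

Lemma target_code w i y z : inhabited w -> (i < size w)%N ->
  box (target w) y -> box (target w) z -> code y i = code z i.
Proof.
move=> iw iw' [_ ay] [_ az]; have [_ _ wN _ _] := target_good iw.
by rewrite ay ?az// (leq_trans iw').
Qed.

(** * The embedding as a limit along each branch of the tree *)

Lemma scaled_ex x : exists y, (x = v -> y = v) /\
  (x <> v -> [/\ y <> v, mu y = mu x / 2 &
                 forall n, box (target (word (code x) n)) y]).
Proof.
have [->|xv] := pselect (x = v); first by exists v.
have x0 : 0 < mu x by exact/(height_gt0 HL).
have x2 : 0 < mu x / 2 by lra.
pose w n := word (code x) n.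
have xw n : mu x <= mu (longest (w n)) by apply: longest_max; exact: cyl_word.
(* The reference leg of the [n]-th target is long enough, since [good] makes it exceed half of
   [longest (w n)]; the image of [x] is a cluster point of these points. *)
pose y n := leg_pt HL (target (w n)).1 (mu x / 2).
have yP n : mu (y n) = mu x / 2 /\ box (target (w n)) (y n).
  have [_ _ _ tl _] := target_good (inhabited_word n xv).
  have xt : 0 < mu x / 2 <= mu (target (w n)).1.
    by have := xw n; rewrite /w; move: tl; lra.
  split; first by rewrite mu_leg_pt//; lra.
  by split; [exact: leg_pt_off_top|move=> i _; rewrite code_leg_pt].
have [z zP] := compact_seq_cluster y cT.
have zge : mu x / 2 <= mu z.
  apply: (zP [set z | mu x / 2 <= mu z] (@closed_height_ge _ _ _ _ _ HL _)).
  by apply: nearW => n /=; rewrite (yP n).1.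
have zle : mu z <= mu x / 2.
  apply: (zP [set z | mu z <= mu x / 2] (@closed_height_le _ _ _ _ _ HL _)).
  by apply: nearW => n /=; rewrite (yP n).1.
have zv : z <> v by apply/(height_gt0 HL); exact: lt_le_trans zge.
exists z; split => // _; split => //; first by apply/eqP; rewrite eq_le zle.
move=> n; split => //.
set t := target _.
suff [_] : [set y | mu x / 2 <= mu y /\ agree t.2 t.1 y] z by [].
apply: (zP _ (@closed_agree _ _ _ _ _ HL t.2 t.1 _ x2)).
near=> m; split; first by rewrite (yP m).1.
have nm : (n <= m)%N by near: m; exact: nbhs_infty_ge.
by have [_] := target_word_sub xv nm (yP m).2.
Unshelve. all: by end_near. Qed.

Definition scaled x := sval (cid (scaled_ex x)).

Lemma scaled_top : scaled v = v.
Proof. by rewrite /scaled; case: cid => y /= [H _]; exact: H. Qed.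

Lemma scaled_off_top x : x <> v -> scaled x <> v.
Proof. by rewrite /scaled; case: cid => y /= [_ H] /H []. Qed.

Lemma mu_scaled x : mu (scaled x) = mu x / 2.
Proof.
have [->|xv] := pselect (x = v); first by rewrite scaled_top (height_top HL) mul0r.
by rewrite /scaled; case: cid => y /= [_ /(_ xv)[]].
Qed.

Lemma scaled_box x n : x <> v -> box (target (word (code x) n)) (scaled x).
Proof. by rewrite /scaled; case: cid => y /= [_ H] /H []. Qed.

(** A good target for [w] fixes at least [size w] bits, so lying in all boxes along a branch
    determines the code. *)
Lemma scaled_uniq x z : x <> v -> mu z = mu x / 2 ->
  (forall n, box (target (word (code x) n)) z) -> scaled x = z.
Proof.
move=> xv mz bz; apply: (leg_inj HL); rewrite ?mu_scaled//.
- exact: scaled_off_top.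
- by have [] := bz 0%N.
move=> i; apply: (@target_code (word (code x) i.+1)) => //.
- exact: inhabited_word.
- by rewrite size_word.
- exact: scaled_box.
Qed.

Lemma scaled_inj : injective scaled.
Proof.
move=> x y xy.
have mxy : mu x = mu y by have := congr1 mu xy; rewrite !mu_scaled; lra.
have [xv|xv] := pselect (x = v).
  by move: mxy; rewrite xv (height_top HL) => /esym/(height_eq0 HL).
have yv : y <> v by apply/(height_gt0 HL); rewrite -mxy; exact/(height_gt0 HL).
apply: (leg_inj HL) => // i.
have := @target_inj (word (code x) i.+1) (word (code y) i.+1) (scaled x).
rewrite !size_word => /(_ erefl (inhabited_word _ xv) (inhabited_word _ yv)).
by rewrite {2}xy => /(_ (scaled_box _ xv) (scaled_box _ yv)) [].
Qed.

Lemma scaled_continuous : continuous scaled.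
Proof.
move=> x; rewrite /continuous_at.
have cm : mu (scaled t) @[t --> x] --> mu x / 2.
  under eq_fun do rewrite mu_scaled.
  by apply: cvgMl; exact: mu_cont.
have [xv|xv] := pselect (x = v).
  have -> : scaled x = v by rewrite xv scaled_top.
  by apply: (cvg_top hT cT HL); move: cm; rewrite {2}xv (height_top HL) mul0r.
apply: (cvg_leg hT cT HL); first exact: scaled_off_top.
  by rewrite mu_scaled.
move=> i; have cx := agree_near HL i.+1 xv.
have vx := off_top_near HL xv.
near=> t.
have tv : t <> v by near: t.
have xt : word (code t) i.+1 = word (code x) i.+1.
  by apply/word_eqP; near: t.
apply: (@target_code (word (code x) i.+1)).
- exact: inhabited_word.
- by rewrite size_word.
- by rewrite -xt; exact: scaled_box.
- exact: scaled_box.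
Unshelve. all: by end_near. Qed.

Lemma scaled_embedding : embedding scaled.
Proof.
exact: (@continuous_inj_embedding _ _ v hT cT _ scaled_continuous scaled_inj).
Qed.

(** A highest point of the fan would be the image of a point twice as high. *)
Lemma scaled_not_surj : range scaled <> setT.
Proof.
have [x0 x0v] := off_top; have i0 : inhabited [::] by exists x0.
move=> rT; have : range scaled (longest [::]) by rewrite rT.
move=> [x _ xm]; have m0 := longest_gt0 i0.
have := congr1 mu xm; rewrite mu_scaled => mx.
have xv : x <> v by apply/(height_gt0 HL); lra.
suff : mu x <= mu (longest [::]) by lra.
exact: longest_max.
Qed.

(** * Levels of target boxes, folding and the retraction *)

Definition level n z := exists w, [/\ size w = n, inhabited w & box (target w) z].

Lemma levelW m n z : (m <= n)%N -> level n z -> level m z.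
Proof.
elim: n => [|n IH]; first by rewrite leqn0 => /eqP->.
rewrite leq_eqVlt => /orP[/eqP->//|]; rewrite ltnS => mn [w [+ ib bw]].
case: w ib bw => [//|b w] ib bw [sw]; have iw := inhabited_cons ib.
by apply: IH => //; exists w; split => //; exact: target_cons bw.
Qed.

Lemma eps_lim (a b : R) : 0 <= b -> (forall n, a <= (1 + eps n) * b) -> a <= b.
Proof.
move=> b0 H.
have cvg_eps : (1 + eps n) * b @[n --> \oo] --> (1 + 0) * b.
  apply: cvgMl; apply: cvgD; first exact: cvg_cst.
  by apply: cvg_expr; rewrite ger0_norm ?invf_lt1// ?ltr1n.
rewrite addr0 mul1r in cvg_eps.
by apply: (ler_cvg_to (@cvg_cst _ a _ _ _) cvg_eps); apply: nearW.
Qed.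

(** The words of the boxes through [z] form a branch. As the error factors tend to 1, its cylinders
    contain points of height close to [2 * mu z]; a cluster point of these has the branch as code
    and is mapped to [z]. *)
Lemma level_range z : (forall n, level n z) -> range scaled z.
Proof.
move=> /choice[w wP].
have zv : z <> v by have [_ _ []] := wP 0%N.
have z0 : 0 < mu z by exact/(height_gt0 HL).
have wS n : exists b, w n.+1 = b :: w n.
  have [sn1 i1 b1] := wP n.+1; have [sn i0 b0] := wP n.
  case: (w n.+1) sn1 i1 b1 => [//|b w'] [sw] i1 b1; exists b; congr cons.
  have iw' := inhabited_cons i1.
  by apply: target_inj b0 => //; [rewrite sw|exact: target_cons b1].
have cylw m n x : (m <= n)%N -> cyl (w n) x -> cyl (w m) x.
  elim: n => [|n IH]; first by rewrite leqn0 => /eqP->.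
  rewrite leq_eqVlt => /orP[/eqP->//|]; rewrite ltnS => /IH {}IH.
  by have [b ->] := wS n => /cyl_cons.
(* The upper bound in [good] gives [2 * mu z <= (1 + eps n) * mu (longest (w n))], so this height
   occurs on the longest leg. *)
pose s n := 2 * mu z / (1 + eps n).
have e1 n : 0 < 1 + eps n by have := eps_gt0 n; lra.
have s0 n : 0 < s n by rewrite divr_gt0// mulr_gt0.
have sle n : s n <= 2 * mu z.
  by rewrite /s ler_pdivrMr// ler_peMr ?mulr_ge0// ?lerDl ltW// eps_gt0.
pose y n := leg_pt HL (longest (w n)) (s n).
have yP n : mu (y n) = s n /\ cyl (w n) (y n).
  have [sn iw bz] := wP n; have [_ tmax _ _ thi] := target_good iw.
  have sl : 0 < s n <= mu (longest (w n)).
    rewrite sn in thi.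
    rewrite s0 /s ler_pdivrMr// [leRHS]mulrC; apply: le_trans thi.
    by rewrite ler_pM2l//; exact: tmax.
  split; first by rewrite mu_leg_pt//; case/andP: sl => /ltW -> ->.
  apply/(cyl_agree (cyl_longest iw)); first exact: leg_pt_off_top.
  by move=> i _; rewrite code_leg_pt.
have [x xP] := compact_seq_cluster y cT.
have xle : mu x <= 2 * mu z.
  apply: (xP [set x | mu x <= 2 * mu z] (@closed_height_le _ _ _ _ _ HL _)).
  by apply: nearW => n /=; rewrite (yP n).1.
have xge n : s n <= mu x.
  apply: (xP [set x | s n <= mu x] (@closed_height_ge _ _ _ _ _ HL _)).
  near=> m => /=; rewrite (yP m).1 /s ler_pM2l ?mulr_gt0//.
  rewrite lef_pV2 ?posrE// lerD2l; apply: eps_le.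
  by near: m; exact: nbhs_infty_ge.
have x0 : 0 < mu x by exact: lt_le_trans (xge 0%N).
have xv : x <> v by exact/(height_gt0 HL).
have mx : mu x = 2 * mu z.
  apply/eqP; rewrite eq_le xle /=; apply: eps_lim; first exact: ltW.
  by move=> n; have := xge n; rewrite /s ler_pdivrMr// [leRHS]mulrC.
exists x => //; apply: scaled_uniq => //; first by rewrite mx; lra.
move=> n; have [sn iw bz] := wP n.
suff -> : word (code x) n = w n by [].
suff [_] : cyl (w n) x by rewrite sn.
apply/(cyl_agree (cyl_longest iw)) => //.
set c := longest _.
suff [_] : [set y | s 0%N <= mu y /\ agree (size (w n)) c y] x by [].
apply: (xP _ (@closed_agree _ _ _ _ _ HL (size (w n)) c _ (s0 0%N))).
near=> m; split.
  rewrite (yP m).1 /s ler_pM2l ?mulr_gt0// lef_pV2 ?posrE// lerD2l.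
  exact: eps_le.
have [mm cm] := yP m.
apply/(cyl_agree (cyl_longest iw)); first by case: cm.
by apply: cylw cm; near: m; exact: nbhs_infty_ge.
Unshelve. all: by end_near. Qed.

(* Points of the box of [w] outside the boxes of its children are folded onto the
   image of the longest leg of the cylinder [w]. *)
Let fold w z :=
  scaled (leg_pt HL (longest w) (mu (longest w) * mu z / mu (target w).1)).

Lemma fold_ratio w z : inhabited w -> box (target w) z ->
  0 < mu (longest w) * mu z / mu (target w).1 <= mu (longest w).
Proof.
move=> iw bz; have [tv tmax _ _ _] := target_good iw.
have t0 : 0 < mu (target w).1 by exact/(height_gt0 HL).
have l0 := longest_gt0 iw.
have z0 : 0 < mu z by apply/(height_gt0 HL); case: bz.
rewrite divr_gt0 ?mulr_gt0//= ler_pdivrMr// ler_pM2l//; exact: tmax.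
Qed.

(** [fold] multiplies heights by the ratio of [mu (longest w)] to [2 * mu (target w).1], which
    [good] places between 1/(1 + eps) and 1: deep folds hardly change heights. *)
Lemma fold_box w z : inhabited w -> box (target w) z ->
  [/\ box (target w) (fold w z), mu (fold w z) <= mu z &
      mu z <= (1 + eps (size w)) * mu (fold w z)].
Proof.
move=> iw bz; have kz := fold_ratio iw bz.
have [tv tmax _ tlo thi] := target_good iw.
have t0 : 0 < mu (target w).1 by exact/(height_gt0 HL).
have l0 := longest_gt0 iw.
have z0 : 0 < mu z by apply/(height_gt0 HL); case: bz.
rewrite /fold; set p := leg_pt HL (longest w) _.
have pv : p <> v by exact: leg_pt_off_top.
have mp : mu p = mu (longest w) * mu z / mu (target w).1.
  by rewrite mu_leg_pt//; case/andP: kz => /ltW -> ->.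
have [_ wp] : cyl w p.
  by apply/(cyl_agree (cyl_longest iw)) => // i _; rewrite code_leg_pt.
split; first by rewrite -{1}wp; exact: scaled_box.
  rewrite mu_scaled mp ler_pdivrMr// ler_pdivrMr//.
  by rewrite [leRHS](_ : _ = 2 * mu (target w).1 * mu z); [rewrite ler_pM2r// ltW|ring].
rewrite mu_scaled mp.
rewrite [leRHS](_ : _ = (1 + eps (size w)) * mu (longest w) * mu z / (2 * mu (target w).1)).
  by rewrite ler_pdivlMr ?mulr_gt0// mulrC ler_pM2r.
by field; rewrite gt_eqF.
Qed.

Lemma level_cases z : z <> v -> (forall n, level n z) \/
  exists w, [/\ inhabited w, box (target w) z & ~ level (size w).+1 z].
Proof.
move=> zv; have [lz|/existsNP nl] := pselect (forall n, level n z); first by left.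
right; apply: contrapT => H; case: nl => n; elim: n => [|n IH l1].
  by apply; exists [::]; split => //; [exists z|exact: target_root].
apply: IH => -[w [sw iw bw]]; apply: H; exists w; split => //.
by rewrite sw.
Qed.

(** A point off [v] and off the image leaves the boxes at a unique last word, since boxes of equal
    length are disjoint and levels decrease; so the three clauses do not conflict. *)
Lemma retract_ex : exists r : T -> T, [/\ r v = v,
  forall z, (forall n, level n z) -> r z = z &
  forall w z, inhabited w -> box (target w) z -> ~ level (size w).+1 z ->
    r z = fold w z].
Proof.
suff /choice[r rP] : forall z, exists y, [/\ z = v -> y = v,
    (forall n, level n z) -> y = z &
    forall w, inhabited w -> box (target w) z -> ~ level (size w).+1 z ->
      y = fold w z].
  exists r; split; first by have [H _ _] := rP v; exact: H.
    by move=> z; have [_ H _] := rP z.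
  by move=> w z; have [_ _ H] := rP z; exact: H.
move=> z; have [->|zv] := pselect (z = v).
  exists v; split => //.
  by move=> w _ [].
have [lz|[w [iw bw nl]]] := level_cases zv.
  by exists z; split => // w iw bz /(_ (lz _)).
exists (fold w z); split => // w' iw' bw' nl'.
congr (fold _ z); apply: (target_inj _ _ _ bw bw') => //.
apply/eqP; rewrite eqn_leq; apply/andP; split; rewrite leqNgt; apply/negP => H.
  by apply: nl'; apply: levelW H _; exists w; split.
by apply: nl; apply: levelW H _; exists w'; split.
Qed.

Lemma scaled_retraction : admits_retraction scaled.
Proof.
have [r [rv rid rfold]] := retract_ex.
(* A point of the box of [w] that is moved is folded at a word no shorter than [w], hence inside
   this box and with an error factor no worse. *)
have rbox w z : inhabited w -> box (target w) z ->
    [/\ box (target w) (r z), mu (r z) <= mu z &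
        mu z <= (1 + eps (size w)) * mu (r z)].
  move=> iw bz; have zv : z <> v by case: bz.
  have ew := eps_gt0 (size w).
  have z0 : 0 < mu z by exact/(height_gt0 HL).
  have [/rid ->|[w' [iw' bz' nl]]] := level_cases zv.
    by split => //; rewrite mulrDl mul1r lerDl mulr_ge0// ltW.
  have ww' : (size w <= size w')%N.
    by rewrite leqNgt; apply/negP => /levelW H; apply: nl; apply: H; exists w; split.
  rewrite (rfold w')//; have [fb fle fge] := fold_box iw' bz'.
  split => //; first exact: (target_sub ww' iw iw' bz bz').
  apply: le_trans fge _; apply: ler_wpM2r; first exact: mu_ge0.
  by rewrite lerD2l; exact: eps_le.
have i0 : inhabited [::] by have [x xv] := off_top; exists x.
have rle z : mu (r z) <= mu z.
  have [->|zv] := pselect (z = v); first by rewrite rv.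
  by have [] := rbox [::] z i0 (target_root zv).
exists r; split.
- move=> z; rewrite /continuous_at; have [->|zv] := pselect (z = v).
    rewrite rv; apply: (cvg_top hT cT HL).
    apply: (@squeeze_cvgr _ _ _ _ (fun=> 0) mu).
    + by apply: nearW => t; rewrite mu_ge0 rle.
    + exact: cvg_cst.
    + by rewrite -(height_top HL); exact: mu_cont.
  have [lz|[w [iw bz nl]]] := level_cases zv.
    rewrite (rid _ lz); apply: (cvg_leg hT cT HL) => //; last first.
      move=> i; have [w [sw iw [_ az]]] := lz i.+1.
      have vz := off_top_near HL zv; have cz := agree_near HL (target w).2 zv.
      near=> t.
      have bt : box (target w) t.
        have zt : agree (target w).2 z t by near: t.
        by split; [near: t|move=> j jw; rewrite zt// az].
      have [brt _ _] := rbox w t iw bt.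
      by apply: (target_code iw _ brt); rewrite ?sw//; split.
    have M0 := longest_gt0 i0; set M := mu (longest [::]) in M0.
    have rM t : mu (r t) <= M.
      have [->|tv] := pselect (t = v); first by rewrite rv (height_top HL) ltW.
      by apply: le_trans (rle t) _; apply: longest_max.
    (* Near an image point the box of length [n] bounds the loss of height by [eps n * M], where [M]
       bounds the heights of all [r t]. *)
    suff cd : mu t - mu (r t) @[t --> z] --> (0 : R).
      have -> : (fun t => mu (r t)) = mu - (fun t => mu t - mu (r t)).
        by apply/funext => t; rewrite !fctE opprB addrC subrK.
      by rewrite -[X in _ --> X]subr0; exact: cvgB (@mu_cont z) cd.
    apply/cvgrPdist_le => e e0.
    have [n ne] : exists n, eps n * M <= e.
      have : eps n * M @[n --> \oo] --> (0 : R).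
        rewrite -[X in _ --> X](mul0r M); apply: cvgMl.
        by apply: cvg_expr; rewrite ger0_norm ?invf_lt1// ?ltr1n.
      by move=> /cvgrPdist_le/(_ e e0)[n _ /(_ n (leqnn n))]; rewrite sub0r normrN;
        exists n; apply: le_trans (ler_norm _) _.
    have [w [sw iw [_ az]]] := lz n.
    have vz := off_top_near HL zv; have cz := agree_near HL (target w).2 zv.
    near=> t.
    have bt : box (target w) t.
      have zt : agree (target w).2 z t by near: t.
      by split; [near: t|move=> j jw; rewrite zt// az].
    have [_ _ tr] := rbox w t iw bt; have := rle t; rewrite sw in tr.
    rewrite sub0r normrN => rt; rewrite ger0_norm ?subr_ge0//.
    apply: le_trans ne; rewrite lerBlDr; apply: le_trans tr _.
    rewrite mulrDl mul1r addrC lerD2r ler_pM2l ?eps_gt0//.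
  rewrite (rfold w)//.
  have [_ az] := bz.
  (* Enough bits to decide membership in the box of [w] and of both its children: points near [z]
     leave at the same word, and there [r] is [fold w]. *)
  pose N := maxn (target w).2 (maxn (target (false :: w)).2 (target (true :: w)).2).
  have vz := off_top_near HL zv; have cz := agree_near HL N zv.
  have near_box : \forall t \near z, box (target w) t.
    near=> t; split; first by near: t.
    move=> j jw; rewrite -az//.
    have aN : agree N z t by near: t.
    by apply: aN; rewrite /N leq_max jw.
  have near_fold : \forall t \near z, fold w t = r t.
    near=> t.
    have bt : box (target w) t by near: t.
    have aN : agree N z t by near: t.
    rewrite (rfold w)// => -[w' [+ ib bb]].
    case: w' ib bb => [//|b w'] ib bb [sw]; apply: nl.
    have ww : w' = w.
      by apply: target_inj bt => //; [exact: inhabited_cons ib|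
        apply: target_cons bb; exact: inhabited_cons ib].
    rewrite ww in ib bb *; exists (b :: w); split => //; split => // j jb.
    have [_ /(_ j jb) <-] := bb; apply/esym/aN; rewrite /N !leq_max.
    by case: (b) jb => /= ->; rewrite !orbT.
  apply: cvg_trans; first by apply: near_eq_cvg; exact: near_fold.
  have cp : leg_pt HL (longest w) (mu (longest w) * mu t / mu (target w).1) @[t --> z]
      --> leg_pt HL (longest w) (mu (longest w) * mu z / mu (target w).1).
    apply: (@leg_pt_cvg _ _ _ _ _ hT cT HL _ (nbhs z) _ (longest w)
      (fun t => mu (longest w) * mu t / mu (target w).1) _ (fold_ratio iw bz)).
      near=> t; have bt : box (target w) t by near: t.
      by have /andP[] := fold_ratio iw bt.
    by apply: cvgMl; apply: cvgMr; exact: mu_cont.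
  exact: cvg_comp cp (@scaled_continuous _).
- move=> z; have [->|zv] := pselect (z = v).
    by rewrite rv; exists v => //; exact: scaled_top.
  have [lz|[w [iw bz nl]]] := level_cases zv.
    by rewrite rid//; exact: level_range.
  by rewrite (rfold w)//; eexists.
- move=> _ [x _ <-]; have [->|xv] := pselect (x = v); first by rewrite scaled_top.
  apply: rid => n; exists (word (code x) n).
  by split; [exact: size_word|exact: inhabited_word|exact: scaled_box].
Unshelve. all: by end_near. Qed.

End SelfEmbedding.

(** * Arcs *)

Section Arcs.
Context {R : realType} {T : pseudoMetricType R}.
Implicit Types (A K : set T) (g : R -> T) (h : T -> R).

Lemma unit_itvE : @unit_itv R = `[0, 1]%classic.
Proof. by apply/seteqP; split => t /=; rewrite in_itv. Qed.

Definition arc_param A g h :=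
  [/\ {within @unit_itv R, continuous g}, g @` @unit_itv R = A,
      {within A, continuous h} & forall t, @unit_itv R t -> h (g t) = t].

Lemma arc_param_inj A g h s t : arc_param A g h ->
  @unit_itv R s -> @unit_itv R t -> g s = g t -> s = t.
Proof. by move=> [_ _ _ hg] s1 t1 gst; rewrite -(hg s)// gst hg. Qed.

Lemma sub_param_continuum A g h a b : arc_param A g h ->
  0 <= a -> a <= b -> b <= 1 -> continuum (g @` `[a, b]).
Proof.
move=> [cg _ _ _] a0 ab b1.
have cgab : {within `[a, b], continuous g}.
  apply: continuous_subspaceW cg => t /=; rewrite in_itv /= /unit_itv /=; lra.
split; first by exists (g a), a => //=; rewrite in_itv /= lexx.
split; first by apply: continuous_compact => //; exact: segment_compact.
by apply: connected_continuous_connected => //; exact: segment_connected.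
Qed.

Lemma arc_continuum A x y : arc_between A x y -> continuum A.
Proof.
move=> [g [h [cg gA ch hg _]]].
have /sub_param_continuum H : arc_param A g h by [].
by have := H 0 1; rewrite -unit_itvE gA; apply.
Qed.

Lemma arc_between_sym A x y : arc_between A x y -> arc_between A y x.
Proof.
move=> [g [h [cg gA ch hg [g0 g1]]]].
have ri : continuous (fun t : R => 1 - t).
  by move=> t; apply: cvgB; [exact: cvg_cst|exact: cvg_id].
exists (g \o (fun t => 1 - t)), ((fun t => 1 - t) \o h); split.
- apply: (continuous_within_comp (continuous_subspaceT ri) cg).
  by move=> _ [t + <-]; rewrite /unit_itv /=; lra.
- rewrite -gA; apply/seteqP; split => _ [t t1 <-].
    by exists (1 - t) => //; move: t1; rewrite /unit_itv /=; lra.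
  exists (1 - t); first by move: t1; rewrite /unit_itv /=; lra.
  by rewrite /= opprB addrC subrK.
- exact: (continuous_within_comp ch (continuous_subspaceT ri) (@subsetT _ _)).
- move=> t t1 /=; rewrite hg; last by move: t1; rewrite /unit_itv /=; lra.
  by rewrite opprB addrC subrK.
- by rewrite /= subr0 subrr.
Qed.

Lemma sub_param_arc A g h a b : arc_param A g h -> 0 <= a -> a < b -> b <= 1 ->
  arc_between (g @` `[a, b]) (g a) (g b).
Proof.
move=> [cg gA ch hg] a0 ab b1.
have ba : 0 < b - a by lra.
have unit_of t : 0 <= t <= 1 -> a <= a + t * (b - a) <= b.
  move=> /andP[t0 t1]; have := mulr_ge0 t0 (ltW ba).
  by have := ler_piMl (ltW ba) t1; lra.
have of_unit t : a <= t <= b -> 0 <= (t - a) / (b - a) <= 1.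
  by move=> /andP[ta tb]; rewrite divr_ge0 ?ler_pdivrMr//=; lra.
have c1 : continuous (fun t : R => a + t * (b - a)).
  by move=> t; apply: cvgD; [exact: cvg_cst|apply: cvgMl; exact: cvg_id].
have c2 : continuous (fun t : R => (t - a) / (b - a)).
  by move=> t; apply: cvgMl; apply: cvgB; [exact: cvg_id|exact: cvg_cst].
exists (g \o (fun t => a + t * (b - a))), ((fun t => (t - a) / (b - a)) \o h); split.
- apply: (continuous_within_comp (continuous_subspaceT c1) cg).
  by move=> _ [t /unit_of + <-]; rewrite /unit_itv /=; lra.
- apply/seteqP; split => _ [t t1 <-].
    by exists (a + t * (b - a)) => //=; rewrite in_itv /=; exact: unit_of.
  exists ((t - a) / (b - a)); first by apply: of_unit; move: t1; rewrite /= in_itv.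
  by rewrite /= divfK ?gt_eqF// addrC subrK.
- apply: (fun H => continuous_within_comp H (continuous_subspaceT c2) (@subsetT _ _)).
  apply: continuous_subspaceW ch; rewrite -gA => _ [t t1 <-]; exists t => //.
  by move: t1; rewrite /= in_itv /= /unit_itv /=; lra.
- move=> t /unit_of t1 /=; rewrite hg; last by rewrite /unit_itv /=; lra.
  by rewrite addrC addKr mulfK// gt_eqF.
- by rewrite /= mul0r addr0 mul1r addrC subrK.
Qed.

Lemma arc_connected_interval A g h K : arc_param A g h ->
  K `<=` A -> connected K -> is_interval (h @` K).
Proof.
move=> [_ _ ch _] KA cK; apply/connected_intervalP.
by apply: connected_continuous_connected => //; exact: continuous_subspaceW ch.
Qed.

Lemma arc_param_mem A g h x : arc_param A g h -> A x ->
  @unit_itv R (h x) /\ g (h x) = x.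
Proof. by move=> [_ <- _ hg] [t t1 <-]; rewrite hg. Qed.

(** [h] maps [K] onto an interval containing 0 and 1. *)
Lemma arc_connected_sub A x y K : arc_between A x y ->
  K `<=` A -> connected K -> K x -> K y -> A `<=` K.
Proof.
move=> [g [h [cg gA ch hg [g0 g1]]]] KA cK Kx Ky z Az.
have gh : arc_param A g h by [].
have [hz1 gz] := arc_param_mem gh Az.
have K0 : (h @` K) 0 by exists x => //; rewrite -g0 hg// /unit_itv /=; lra.
have K1 : (h @` K) 1 by exists y => //; rewrite -g1 hg// /unit_itv /=; lra.
have [k Kk kz] := arc_connected_interval gh KA cK K0 K1 hz1.
by have [_ gk] := arc_param_mem gh (KA _ Kk); rewrite -gz -kz gk.
Qed.

(* Otherwise the arc reparametrised from its other end would cross the interior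
   point twice. *)
Lemma arc_interior_not_endpoint A g h t : arc_param A g h -> 0 < t < 1 ->
  ~ arc_endpoint A (g t).
Proof.
move=> gh /andP[t0 t1] [b [k [l [ck kA cl lk [k0 _]]]]].
have [cg gA ch hg] := gh.
have u0 : @unit_itv R 0 by rewrite /unit_itv /=; lra.
have u1 : @unit_itv R 1 by rewrite /unit_itv /=; lra.
have ut : @unit_itv R t by rewrite /unit_itv /=; lra.
have kl : arc_param A k l by [].
have Ag s : @unit_itv R s -> A (g s) by move=> us; rewrite -gA; exists s.
have [p0 kp0] := arc_param_mem kl (Ag 0 u0).
have [p1 kp1] := arc_param_mem kl (Ag 1 u1).
pose f := h \o k.
have cf : {within @unit_itv R, continuous f}.
  by apply: continuous_within_comp ck ch _; rewrite kA.
have f0 : f (l (g 0)) = 0 by rewrite /f /= kp0 hg.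
have f1 : f (l (g 1)) = 1 by rewrite /f /= kp1 hg.
have pos s : @unit_itv R s -> f s <> t -> 0 < s.
  move=> us fs; have := us; rewrite /unit_itv /= => /andP[s0 _].
  rewrite lt_neqAle s0 andbT; apply/eqP => s0'; apply: fs.
  by rewrite -s0' /f /= k0 hg.
have q0 : 0 < l (g 0) by apply: pos => //; rewrite f0; lra.
have q1 : 0 < l (g 1) by apply: pos => //; rewrite f1; lra.
(* [f] takes the values 0 and 1 at positive parameters, hence [t] at a positive one, whereas [k 0]
   is already the point [g t]. *)
have [s [us s0 fs]] : exists s, [/\ @unit_itv R s, 0 < s & f s = t].
  have := p0; have := p1; rewrite /unit_itv /= => P1 P0.
  have [le01|/ltW le10] := leP (l (g 0)) (l (g 1)).
    have [||s sI fs] := @IVT R f _ _ t le01.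
    - by apply: continuous_subspaceW cf => s /=; rewrite in_itv /= /unit_itv /=; lra.
    - by rewrite f0 f1 min_l ?max_r//; lra.
    by exists s; move: sI; rewrite in_itv /= /unit_itv /= => sI; split => //; lra.
  have [||s sI fs] := @IVT R f _ _ t le10.
  - by apply: continuous_subspaceW cf => s /=; rewrite in_itv /= /unit_itv /=; lra.
  - by rewrite f0 f1 min_r ?max_l//; lra.
  by exists s; move: sI; rewrite in_itv /= /unit_itv /= => sI; split => //; lra.
have Aks : A (k s) by rewrite -kA; exists s.
have ks : k s = k 0.
  by have [_ <-] := arc_param_mem gh Aks; rewrite -[h (k s)]/(f s) fs k0.
by have := arc_param_inj kl us u0 ks; lra.
Qed.

End Arcs.

(** * Legs of a smooth fan *)

Section SmoothFan.
Context {R : realType} {T : pseudoMetricType R} (v : T).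
Hypotheses (hT : hausdorff_space T) (cT : compact [set: T]).
Hypothesis acT : arcwise_connected [set: T].
Hypothesis huT : hereditarily_unicoherent [set: T].
Hypothesis ramT : forall w, ramification_point [set: T] w -> w = v.

(** * Continua and the order of the arms *)

Lemma continuum_set1 (x : T) : continuum [set x].
Proof. by split; [exists x|split; [exact: compact_set1|exact: connected1]]. Qed.

Lemma continuum_closed (A : set T) : continuum A -> closed A.
Proof. by move=> [_ [cA _]]; exact: compact_closed. Qed.

Lemma continuumU (A B : set T) : continuum A -> continuum B ->
  A `&` B !=set0 -> continuum (A `|` B).
Proof.
move=> [[a Aa] [cA ccA]] [_ [cB ccB]] AB; split; first by exists a; left.
by split; [exact: compactU|exact: connectedU].
Qed.

Lemma continuumI_connected (A B : set T) : continuum A -> continuum B ->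
  A `&` B !=set0 -> connected (A `&` B).
Proof. by move=> cA cB AB; exact: (huT (@subsetT _ _) (continuumU cA cB AB)). Qed.

(** By [arm_eq] this is the arc from [v] to [x]; as an intersection of continua it involves no
    choice and covers [x = v]. *)
Definition arm x := [set y | forall K, continuum K -> K v -> K x -> K y].

Lemma arm_refl x : arm x x. Proof. by move=> K. Qed.

Lemma arm_top x : arm x v. Proof. by move=> K. Qed.

Lemma arm_of_top : arm v = [set v].
Proof.
apply/seteqP; split => [y|_ ->]; last exact: arm_refl.
by apply => //; exact: continuum_set1.
Qed.

(** By unicoherence an arc from [v] to [x] meets every continuum through both points in a connected
    set, which must be the whole arc. *)
Lemma arm_eq A x : arc_between A v x -> arm x = A.
Proof.
move=> Avx; have cA := arc_continuum Avx.
have [g [h [_ gA _ _ [g0 g1]]]] := Avx.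
have Av : A v by rewrite -gA -g0; exists 0 => //; rewrite /unit_itv /=; lra.
have Ax : A x by rewrite -gA -g1; exists 1 => //; rewrite /unit_itv /=; lra.
apply/seteqP; split; first by move=> y; exact.
move=> y Ay K cK Kv Kx.
have AK : A `&` K !=set0 by exists v.
have sub : A `&` K `<=` A by move=> ? [].
have cAK := continuumI_connected cA cK AK.
by have [] := arc_connected_sub Avx sub cAK (conj Av Kv) (conj Ax Kx) Ay.
Qed.

Lemma arm_arc x : x <> v -> arc_between (arm x) v x.
Proof.
move=> /nesym vx; have [//|//|A _ Avx] := acT _ _ vx.
by rewrite (arm_eq Avx).
Qed.

Lemma arm_continuum x : continuum (arm x).
Proof.
have [->|xv] := pselect (x = v); first by rewrite arm_of_top; exact: continuum_set1.
exact: arc_continuum (arm_arc xv).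
Qed.

Lemma arm_sub x y : arm x y -> arm y `<=` arm x.
Proof. by move=> xy z; apply; [exact: arm_continuum|exact: arm_top|]. Qed.

Lemma arm_param x : x <> v ->
  exists g h, [/\ arc_param (arm x) g h, g 0 = v & g 1 = x].
Proof. by move=> /arm_arc[g [h [cg gA ch hg [g0 g1]]]]; exists g, h. Qed.

Lemma arm_param_sub x g h t : arc_param (arm x) g h -> g 0 = v ->
  0 <= t <= 1 -> arm (g t) = g @` `[0, t].
Proof.
move=> gh g0 /andP[t0 t1]; have [->|/eqP/nesym tn0] := eqVneq t 0.
  by rewrite g0 arm_of_top set_itv1 image_set1 g0.
have tp : 0 < t by rewrite lt_neqAle t0 andbT; apply/eqP.
by apply: arm_eq; have := sub_param_arc gh (lexx 0) tp t1; rewrite g0.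
Qed.

Lemma arm_mem x y g h : arc_param (arm x) g h -> arm x y ->
  0 <= h y <= 1 /\ g (h y) = y.
Proof. by move=> gh xy; have [] := arc_param_mem gh xy. Qed.

Lemma arm_antisym x y : arm x y -> arm y x -> x = y.
Proof.
move=> xy yx; have [xv|xv] := pselect (x = v).
  by move: xy; rewrite xv arm_of_top.
have [g [h [gh g0 g1]]] := arm_param xv.
have [hy gy] := arm_mem gh xy.
move: yx; rewrite -gy (arm_param_sub gh g0 hy) => -[t + gt].
rewrite /= in_itv /= => ty.
have u1 : @unit_itv R 1 by rewrite /unit_itv /=; lra.
have ut : @unit_itv R t by rewrite /unit_itv /=; lra.
have t1 : t = 1 by apply: (arc_param_inj gh ut u1); rewrite gt g1.
by rewrite -[LHS]g1; congr g; lra.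
Qed.

(** [C] is the part of the arm of [x] from [y] on; it carries locally constant properties between
    comparable points. *)
Lemma arm_beyond x y : arm x y -> exists C,
  [/\ connected C, C x, C y & forall z, C z -> arm x z /\ arm z y].
Proof.
move=> xy; have [xv|xv] := pselect (x = v).
  exists [set v]; move: xy; rewrite xv arm_of_top => ->; split => //.
    exact: connected1.
  by move=> _ ->; split => //; exact: arm_refl.
have [g [h [gh g0 g1]]] := arm_param xv.
have [hy gy] := arm_mem gh xy.
have [/andP[hy0 hy1]] := (hy, tt).
have [_ gA _ _] := gh.
exists (g @` `[h y, 1]); split.
- by have [_ []] := sub_param_continuum gh hy0 hy1 (lexx 1).
- by exists 1 => //=; rewrite in_itv /= hy1 lexx.
- by exists (h y) => //=; rewrite in_itv /= hy1 lexx.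
move=> _ [t + <-]; rewrite /= in_itv /= => /andP[t0 t1]; split.
  by rewrite -gA; exists t => //; rewrite /unit_itv /=; lra.
have t01 : 0 <= t <= 1 by lra.
rewrite (arm_param_sub gh g0 t01); exists (h y) => //.
by rewrite /= in_itv /= hy0.
Qed.

(** The common part of the arms is the arm of its point [m] farthest along [h]. If [m] were not [v],
    both arms would continue beyond it and [m] would be the top of a triod. *)
Lemma arm_fork x y : ~ arm x y -> ~ arm y x -> arm x `&` arm y = [set v].
Proof.
move=> nxy nyx; apply/seteqP; split; last by move=> _ ->; split; exact: arm_top.
move=> p [xp yp] /=; apply: contrapT => pv.
have xv : x <> v by move=> xv; apply: nyx; rewrite xv; exact: arm_top.
have yv : y <> v by move=> yv; apply: nxy; rewrite yv; exact: arm_top.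
have [g [h [gh g0 g1]]] := arm_param xv.
have [k [l [kl k0 k1]]] := arm_param yv.
pose I := arm x `&` arm y.
have Iv : I v by split; exact: arm_top.
have cI : connected I.
  by apply: continuumI_connected; [exact: arm_continuum|exact: arm_continuum|exists v].
have clI : closed I.
  by apply: closedI; apply: continuum_closed; exact: arm_continuum.
have Ix : I `<=` arm x by move=> ? [].
have [m Im mmax] : exists2 m, I m & forall z, I z -> h z <= h m.
  have [||m] := @compact_EVT_max T R h I _ (subclosed_compact clI cT (@subsetT _ _)).
  - by exists v.
  - by have [_ _ ch _] := gh; exact: continuous_subspaceW ch.
  by rewrite inE => Im mmax; exists m => // z Iz; apply: mmax; rewrite inE.
have [xm ym] := Im.
have [hm gm] := arm_mem gh xm; have [lm km] := arm_mem kl ym.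
have u0 : @unit_itv R 0 by rewrite /unit_itv /=; lra.
have u1 : @unit_itv R 1 by rewrite /unit_itv /=; lra.
have IE : I = arm m.
  apply/seteqP; split; last by move=> z mz; split; [exact: (arm_sub xm)|exact: (arm_sub ym)].
  move=> z Iz; rewrite -gm (arm_param_sub gh g0 hm).
  have [hz gz] := arm_mem gh (Ix _ Iz).
  by exists (h z) => //=; rewrite in_itv /= mmax//; case/andP: hz => ->.
have mv : m <> v.
  by move=> mv; apply: pv; have : I p by []; rewrite IE mv arm_of_top.
have hm0 : 0 < h m.
  case/andP: (hm) => hm0 _; rewrite lt_neqAle hm0 andbT; apply/eqP => hm0'.
  by apply: mv; rewrite -gm -hm0' g0.
have hm1 : h m < 1.
  case/andP: (hm) => _ hm1; rewrite lt_neqAle hm1 andbT; apply/eqP => hm1'.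
  by apply: nyx; rewrite -g1 -hm1' gm.
have lm1 : l m < 1.
  case/andP: (lm) => _ lm1; rewrite lt_neqAle lm1 andbT; apply/eqP => lm1'.
  by apply: nxy; rewrite -k1 -lm1' km.
have lm0 : 0 <= l m by case/andP: lm.
have mE1 := arm_param_sub gh g0 hm; rewrite gm in mE1.
have mE2 := arm_param_sub kl k0 lm; rewrite km in mE2.
have [_ gA _ _] := gh; have [_ kA _ _] := kl.
have up1 : g @` `[h m, 1] `&` arm m `<=` [set m].
  move=> _ [[t + <-]]; rewrite /= in_itv /= => t1.
  rewrite mE1 => -[s + gst]; rewrite /= in_itv /= => s1.
  have ut : @unit_itv R t by rewrite /unit_itv /=; lra.
  have us : @unit_itv R s by rewrite /unit_itv /=; lra.
  have st := arc_param_inj gh us ut gst.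
  by rewrite -gm; congr g; lra.
have up2 : k @` `[l m, 1] `&` arm m `<=` [set m].
  move=> _ [[t + <-]]; rewrite /= in_itv /= => t1.
  rewrite mE2 => -[s + kst]; rewrite /= in_itv /= => s1.
  have ut : @unit_itv R t by rewrite /unit_itv /=; lra.
  have us : @unit_itv R s by rewrite /unit_itv /=; lra.
  have st := arc_param_inj kl us ut kst.
  by rewrite -km; congr k; lra.
have m1 : (g @` `[h m, 1]) m by exists (h m) => //; rewrite /= in_itv /= lexx ltW.
have m2 : (k @` `[l m, 1]) m by exists (l m) => //; rewrite /= in_itv /= lexx ltW.
apply/mv/ramT.
(* The triod at [m]: back to [v], and outward to [x] and to [y]. *)
exists (arm m), (g @` `[h m, 1]), (k @` `[l m, 1]); split => //.
  split; first by exists v; apply: arc_between_sym; exact: arm_arc.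
  split.
    by exists (g 1); have := sub_param_arc gh (ltW hm0) hm1 (lexx 1); rewrite gm.
  by exists (k 1); have := sub_param_arc kl lm0 lm1 (lexx 1); rewrite km.
split; apply/seteqP; split.
- by rewrite setIC.
- by move=> _ ->; split => //; exact: arm_refl.
- move=> z [gz kz]; apply: up1; split => //; rewrite -IE; split.
    case: gz => t + <-; rewrite /= in_itv /= => t1; rewrite -gA; exists t => //.
    by rewrite /unit_itv /=; lra.
  case: kz => t + <-; rewrite /= in_itv /= => t1; rewrite -kA; exists t => //.
  by rewrite /unit_itv /=; lra.
- by move=> _ ->; split.
- by rewrite setIC.
- by move=> _ ->; split => //; exact: arm_refl.
Qed.

(* Off the top, a continuum cannot join two different legs: by unicoherence it
   would meet the union of the two arms in a connected set avoiding the top. *)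
Lemma continuum_off_top K x y : continuum K -> ~ K v -> K x -> K y ->
  arm x y \/ arm y x.
Proof.
move=> cK Kv Kx Ky; apply: contrapT => /not_orP[nxy nyx].
have xy := arm_fork nxy nyx.
have [cx cy] := (arm_continuum x, arm_continuum y).
have cxy : continuum (arm x `|` arm y).
  by apply: continuumU => //; exists v; split; exact: arm_top.
have cI : connected ((arm x `|` arm y) `&` K).
  by apply: continuumI_connected => //; exists x; split => //; left; exact: arm_refl.
have [clx cly] := (continuum_closed cx, continuum_closed cy).
have clK := continuum_closed cK.
apply: (@connected_closed_split _ _ (arm x `&` K) (arm y `&` K) x y cI).
- exact: closedI.
- exact: closedI.
- by rewrite -setIIl xy; apply/seteqP; split => // _ [-> /Kv].
- by move=> z [[?|?] ?]; [left|right].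
- by split => //; left; exact: arm_refl.
- by split => //; exact: arm_refl.
- by split => //; right; exact: arm_refl.
- by split => //; exact: arm_refl.
Qed.

(** * Continuity of the arms and the height function *)

Hypothesis smoothT : forall (x : T) (u : nat -> T) (A : nat -> set T) (B : set T),
  [set: T] x -> (forall n, [set: T] (u n)) -> u @ \oo --> x ->
  (forall n, arc_from [set: T] v (u n) (A n)) -> arc_from [set: T] v x B ->
  hausdorff_cvg A B.

Lemma arm_from x : arc_from [set: T] v x (arm x).
Proof.
split => //; case: pselect => [xv|xv] /=; first by rewrite xv arm_of_top.
exact: arm_arc.
Qed.

(** Smoothness speaks of sequences; if the claim failed, bad points in the balls of radius 1/(n+1)
    would form a sequence contradicting it. *)
Lemma arm_near x (e : R) : 0 < e ->
  \forall u \near x, arm u `<=` set_nbhd (arm x) e /\ arm x `<=` set_nbhd (arm u) e.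
Proof.
move=> e0; apply: contrapT => nP.
have /choice[u uP] : forall n, exists u, ball x (n.+1%:R^-1) u /\
    ~ (arm u `<=` set_nbhd (arm x) e /\ arm x `<=` set_nbhd (arm u) e).
  move=> n; apply: contrapT => /forallNP H; apply: nP.
  apply/nbhs_ballP; exists n.+1%:R^-1; first by rewrite /= invr_gt0.
  by move=> u xu; apply: contrapT => nu; apply: (H u).
have ux : u @ \oo --> x.
  apply/cvg_ballP => d d0; near=> n.
  apply: (@le_ball _ _ _ n.+1%:R^-1); last by have [] := uP n.
  by apply/ltW; near: n; exact: (near_infty_natSinv_lt (PosNum d0)).
have := smoothT (I : setT x) (fun=> I) ux (fun n => arm_from (u n)) (arm_from x).
by move=> /(_ e e0)[n _ /(_ n (leqnn n))]; have [] := uP n.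
Unshelve. all: by end_near. Qed.

(* The distance from [q] to the arm of [x], truncated at 1. *)
Definition reach q x :=
  inf [set e : R | 0 < e /\ (1 <= e \/ exists2 a, arm x a & ball q e a)].

Lemma reach_le q x e : 0 < e -> 1 <= e \/ (exists2 a, arm x a & ball q e a) ->
  reach q x <= e.
Proof. by move=> e0 H; apply: ge_inf; [exists 0 => d [/ltW]|split]. Qed.

Lemma reach_ge q x c : c <= 1 -> (forall e a, 0 < e -> arm x a -> ball q e a -> c <= e) ->
  c <= reach q x.
Proof.
move=> c1 H; apply: lb_le_inf; first by exists 1; split => //; left.
by move=> e [e0 [/(le_trans c1)//|[a xa qa]]]; exact: H qa.
Qed.

Lemma reach_ge0 q x : 0 <= reach q x.
Proof. by apply: reach_ge => // e a /ltW. Qed.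

Lemma reach_le1 q x : reach q x <= 1.
Proof. by apply: reach_le => //; left. Qed.

Lemma reach_antitone q x y : arm y x -> reach q y <= reach q x.
Proof.
move=> yx; apply: reach_ge; first exact: reach_le1.
by move=> e a e0 xa qa; apply: reach_le => //; right; exists a => //; exact: arm_sub xa.
Qed.

Lemma reach_set_nbhd q x u e : 0 < e -> arm u `<=` set_nbhd (arm x) e ->
  reach q x <= reach q u + e.
Proof.
move=> e0 ux; rewrite -lerBlDr; apply: reach_ge.
  by have := reach_le1 q x; lra.
move=> d a d0 ua qa; rewrite lerBlDr; have [b xb ba] := ux _ ua.
apply: reach_le; first by lra.
by right; exists b => //; apply: ball_triangle qa _; exact: ball_sym.
Qed.

Lemma reach_continuous q : continuous (reach q).
Proof.
move=> x; apply/cvgrPdist_le => e e0; apply: filterS (arm_near x e0) => u [ux xu].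
by rewrite ler_norml; have := reach_set_nbhd q e0 ux; have := reach_set_nbhd q e0 xu; lra.
Qed.

Lemma dense_sequence : exists q : nat -> T, forall x (e : R), 0 < e ->
  exists k, ball (q k) e x.
Proof.
have /choice[l lP] : forall m : nat, exists l : seq T, forall x, [set: T] x ->
    exists2 j, (j < size l)%N & ball (nth v l j) m.+1%:R^-1 x.
  move=> m; apply: (@compact_finite_subcover T setT T v (fun a => ball a (m.+1%:R^-1 : R))) => //.
  by move=> x _; exists x; apply: nbhsx_ballx; rewrite invr_gt0.
have [q qP] := enumerate_lists v l.
exists q => x e e0; have [m me] := ltr_add_invr e0; rewrite add0r in me.
have [j jm bx] := lP m x I; have [k qk] := qP m j jm.
by exists k; rewrite qk; apply: le_ball bx; exact: ltW.
Qed.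

(** A ball of some radius [e] around [y] misses the arm of [x]. For [q k] within [e / 4] of [y], the
    reach is at most [e / 4] for [y] and at least [e / 2] for [x]. *)
Lemma reach_separates (q : nat -> T) x y :
  (forall x (e : R), 0 < e -> exists k, ball (q k) e x) ->
  arm y x -> x <> y -> exists k, reach (q k) y < reach (q k) x.
Proof.
move=> qP yx xy.
have nxy : ~ arm x y by move=> xy'; apply: xy; exact: arm_antisym.
have [e0 e0_gt0 xe0] : exists2 e : R, 0 < e & forall a, arm x a -> ~ ball y e a.
  have oA : open (~` arm x).
    by apply: closed_openC; apply: continuum_closed; exact: arm_continuum.
  have /nbhs_ballP[e e0 H] : nbhs y (~` arm x) by exact: open_nbhs_nbhs.
  exists e => // a xa ya; exact: (H a ya).
(* [reach] never exceeds 1, so the lower bound sought for it has to be capped. *)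
pose e := Num.min e0 1.
have [ee0 e1] : e <= e0 /\ e <= 1 by rewrite /e !ge_min !lexx orbT.
have e_gt0 : 0 < e by rewrite /e lt_min e0_gt0 ltr01.
have e4 : 0 < e / 4 by lra.
have [k kP] := qP y (e / 4) e4; exists k.
apply: (@le_lt_trans _ _ (e / 4)).
  by apply: reach_le => //; right; exists y => //; exact: arm_refl.
apply: (@lt_le_trans _ _ (e / 2)); first by lra.
apply: reach_ge; first by lra.
move=> d a d0 xa ka; rewrite leNgt; apply/negP => de.
apply: (xe0 a xa); apply: (@le_ball _ _ _ (e / 4 + d)); first by lra.
by apply: ball_triangle ka; exact: ball_sym.
Qed.

(** Distances to the arm decrease as the arm grows. A weighted sum of these decreases over a dense
    sequence vanishes at [v] and is strictly increasing along arms. *)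
Lemma height_ex : exists mu : T -> R, [/\ continuous mu, mu v = 0 &
  forall x y, arm y x -> x <> y -> mu x < mu y].
Proof.
have [q qP] := dense_sequence.
have [||mu [cmu mu0 muP]] := @bounded_series R T (fun k x => reach (q k) v - reach (q k) x).
- move=> k x; have := reach_antitone (q k) (@arm_top x).
  by have := reach_ge0 (q k) x; have := reach_le1 (q k) v; lra.
- by move=> k x; apply: cvgB; [exact: cvg_cst|exact: reach_continuous].
exists mu; split => //; first by apply: mu0 => k; rewrite subrr.
move=> x y yx xy; have [|_] := muP x y.
  by move=> k; rewrite lerD2l lerN2; exact: reach_antitone.
by apply; have [k kP] := reach_separates qP yx xy; exists k; rewrite ltrD2l ltrN2.
Qed.

(** * Separation of the legs by countably many clopen sets *)

Section Height.
Variable mu : T -> R.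
Hypotheses (mu_cont : continuous mu) (mu_v : mu v = 0).
Hypothesis mu_lt : forall x y, arm y x -> x <> y -> mu x < mu y.

Lemma height_le x y : arm y x -> mu x <= mu y.
Proof.
by move=> yx; have [->//|xy] := pselect (x = y); exact/ltW/mu_lt.
Qed.

Lemma height_pos x : x <> v -> 0 < mu x.
Proof. by move=> /nesym vx; rewrite -mu_v; apply: mu_lt => //; exact: arm_top. Qed.

Lemma arm_height x s : 0 <= s <= mu x -> exists2 y, arm x y & mu y = s.
Proof.
move=> s01; have [xv|xv] := pselect (x = v).
  by exists v; [exact: arm_top|move: s01; rewrite xv mu_v; lra].
have [g [h [gh g0 g1]]] := arm_param xv; have [cg gA _ _] := gh.
have [||t tI ft] := @IVT R (mu \o g) 0 1 s ler01.
- rewrite -unit_itvE.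
  exact: (continuous_within_comp cg (continuous_subspaceT mu_cont) (@subsetT _ _)).
- by rewrite /= g0 g1 mu_v min_l ?max_r//; lra.
by exists (g t) => //; rewrite -gA; exists t => //; move: tI; rewrite in_itv.
Qed.

Let lev (s : R) := [set x | s <= mu x].

Lemma closed_lev s : closed (lev s).
Proof.
apply: (@preimage_closed T R mu [set t | s <= t]); last exact: closed_ge.
by move=> x _; exact: mu_cont.
Qed.

(** The closure of [C] stays in the closed set [lev s], which misses [v] since [s > 0], and
    [continuum_off_top] applies to it. *)
Lemma connected_lev_comparable s C x y : 0 < s -> connected C -> C `<=` lev s ->
  C x -> C y -> arm x y \/ arm y x.
Proof.
move=> s0 cC Cs Cx Cy.
have Ks : closure C `<=` lev s.
  by rewrite [lev s](closure_id _).1; [exact: closureS|exact: closed_lev].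
apply: (@continuum_off_top (closure C)); try exact: subset_closure.
- split; first by exists x; exact: subset_closure.
  split; last exact: connected_closure.
  by apply: subclosed_compact cT _ => //; exact: closed_closure.
- by move=> /Ks; rewrite /lev /= mu_v; lra.
Qed.

Definition split_level s (E : set T) :=
  [/\ closed E, closed (lev s `\` E) & E `<=` lev s].

(** Comparable points are joined by a piece of arm that stays above the lower one, hence inside
    [lev s]; being connected, it cannot cross the splitting. *)
Lemma split_level_saturated s E x y : split_level s E -> lev s x -> lev s y ->
  arm x y \/ arm y x -> E x -> E y.
Proof.
move=> [clE clE' EL].
have key a b : lev s a -> lev s b -> arm a b -> E a <-> E b.
  move=> la lb ab; have [C [cC Ca Cb CP]] := arm_beyond ab.
  have CL z : C z -> lev s z by move=> /CP[_ /height_le]; exact: le_trans.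
  have CE : C `<=` E `|` (lev s `\` E).
    by move=> z Cz; have [Ez|nEz] := pselect (E z); [left|right; split => //; exact: CL].
  have E0 : E `&` (lev s `\` E) = set0 by rewrite setDIK.
  split => [Ea|Eb]; apply: contrapT => nE.
    by apply: (@connected_closed_split _ C E (lev s `\` E) a b).
  by apply: (@connected_closed_split _ C E (lev s `\` E) b a).
by move=> lx ly [xy|yx]; [exact: (key x y lx ly xy).1|exact: (key y x ly lx yx).2].
Qed.

(** A connected subset of [lev s'] contains only comparable points, and [E] is saturated, so it
    cannot join [E] to the rest of [lev s]; [compact_separation] then applies. *)
Lemma split_level_extend s s' E : 0 < s' -> s' <= s -> split_level s E ->
  exists E', [/\ split_level s' E', E `<=` E' & E' `&` (lev s `\` E) = set0].
Proof.
move=> s'0 ss' sE; have [clE clE' EL] := sE.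
have Ls : lev s `<=` lev s' by move=> x; exact: le_trans.
have [| | | | | |E' [? ? ? ? ?]] := @compact_separation R T (lev s') E (lev s `\` E) cT.
- exact: closed_lev.
- exact: clE.
- exact: clE'.
- exact: subset_trans Ls.
- by move=> x [/Ls].
- move=> C x y cC CL Cx Ex Cy [ly nEy]; apply: nEy.
  apply: (split_level_saturated sE (EL _ Ex)) => //.
  exact: connected_lev_comparable CL _ _.
by exists E'.
Qed.

(** Clopen in the complement of [v], phrased as local constancy to suit
    [connected_locally_constant]. *)
Definition leg_clopen (W : set T) := forall z, z <> v -> \forall t \near z, W t <-> W z.

(* A clopen splitting of {mu >= s} extends to {mu >= s/2^k} for every k, since no
   connected set missing the top joins two legs. *)
Lemma separate_legs x y : x <> v -> mu x = mu y -> x <> y ->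
  exists W, [/\ leg_clopen W, W x & ~ W y].
Proof.
move=> xv mxy xy.
pose sk k := mu x / 2 ^+ k.
have s_gt0 k : 0 < sk k by rewrite divr_gt0 ?exprn_gt0//; exact: height_pos.
have sS k : sk k.+1 <= sk k.
  by have := s_gt0 k; rewrite /sk exprS invfM mulrCA; lra.
have s_le m n : (m <= n)%N -> sk n <= sk m.
  elim: n => [|n IH]; first by rewrite leqn0 => /eqP->.
  rewrite leq_eqVlt => /orP[/eqP->//|]; rewrite ltnS => /IH; exact: le_trans.
(* Distinct points of equal height are incomparable, so no connected part of the level [mu x] joins
   [x] to [y]. *)
have [E0 [sE0 E0x E0y]] : exists E, [/\ split_level (sk 0%N) E, E x & ~ E y].
  have cl1 (z : T) : closed [set z] by exact: compact_closed (@compact_set1 _ z).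
  have s0E : sk 0%N = mu x by rewrite /sk expr0 divr1.
  have [| | | | | |E' [? ? ? Px EQ]] := @compact_separation R T (lev (sk 0%N)) [set x] [set y] cT.
  - exact: closed_lev.
  - exact: cl1.
  - exact: cl1.
  - by move=> _ ->; rewrite /lev /= s0E.
  - by move=> _ ->; rewrite /lev /= s0E mxy.
  - move=> C a b cC CL + ax + bY; rewrite {}ax {}bY => Cx Cy.
    have [xy'|yx] := connected_lev_comparable (s_gt0 0%N) cC CL Cx Cy.
      by have := mu_lt xy' (nesym xy); rewrite mxy ltxx.
    by have := mu_lt yx xy; rewrite mxy ltxx.
  exists E'; split => //; first exact: Px.
  by move=> Ey; have : (E' `&` [set y]) y by []; rewrite EQ.
have /choice[F FP] : forall kE : nat * set T, exists E', split_level (sk kE.1) kE.2 ->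
    [/\ split_level (sk kE.1.+1) E', kE.2 `<=` E' & E' `&` (lev (sk kE.1) `\` kE.2) = set0].
  move=> [k E] /=; have [sE|] := pselect (split_level (sk k) E); last by exists E.
  by have [E' ?] := split_level_extend (s_gt0 k.+1) (sS k) sE; exists E'.
pose fix Es k := if k is m.+1 then F (m, Es m) else E0.
have sEs k : split_level (sk k) (Es k).
  by elim: k => // k IH /=; have [] := FP (k, Es k) IH.
have EsS k : Es k `<=` Es k.+1 by have [] := FP (k, Es k) (sEs k).
(* Later stages add nothing to an earlier level, so the union [W] of the stages restricts to [Es m]
   on [lev (sk m)]. *)
have Es_restr m n z : (m <= n)%N -> Es n z -> lev (sk m) z -> Es m z.
  elim: n => [|n IH]; first by rewrite leqn0 => /eqP->.
  rewrite leq_eqVlt => /orP[/eqP->//|]; rewrite ltnS => mn Ez lz; apply: IH => //.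
  apply: contrapT => nEz; have [_ _ dis] := FP (n, Es n) (sEs n).
  have : (Es n.+1 `&` (lev (sk n) `\` Es n)) z.
    by split => //; split => //; exact: le_trans (s_le _ _ mn) lz.
  by rewrite dis.
have Es_le m n : (m <= n)%N -> Es m `<=` Es n.
  elim: n => [|n IH]; first by rewrite leqn0 => /eqP->.
  rewrite leq_eqVlt => /orP[/eqP->//|]; rewrite ltnS => /IH H.
  exact: subset_trans H (EsS n).
pose W := \bigcup_k Es k.
have WE m z : lev (sk m) z -> W z <-> Es m z.
  move=> lz; split => [[n _ Ez]|Ez]; last by exists m.
  have [mn|/ltnW nm] := leqP m n; first exact: Es_restr Ez lz.
  exact: Es_le nm _ Ez.
exists W; split; last first.
- move=> /(WE 0%N) H; apply: E0y; apply: H.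
  by rewrite /lev /= /sk expr0 divr1 mxy.
- by exists 0%N.
move=> z zv.
(* On a level reaching strictly below [z], [W] is the stage [Es k], which is relatively clopen
   there. *)
have [k kz] : exists k, sk k < mu z.
  have : sk k @[k --> \oo] --> mu x * 0.
    apply: cvgMr; under eq_fun do rewrite -exprVn.
    by apply: cvg_expr; rewrite ger0_norm ?invf_lt1// ?ltr1n.
  rewrite mulr0 => /cvgrPdist_lt/(_ (mu z) (height_pos zv))[k _ /(_ k (leqnn k))].
  by rewrite sub0r normrN => H; exists k; exact: le_lt_trans (ler_norm _) H.
have lnear : \forall t \near z, lev (sk k) t.
  have H : \forall t \near z, sk k < mu t.
    by apply: (@mu_cont z [set t | sk k < t]); exact: lt_nbhsr.
  by apply: filterS H => t; exact: ltW.
have [clE clE' EL] := sEs k.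
have lz : lev (sk k) z by exact: ltW.
have [Ez|nEz] := pselect (Es k z).
  have Enear : \forall t \near z, ~ (lev (sk k) `\` Es k) t.
    by apply: open_nbhs_nbhs; split; [exact: closed_openC|case].
  apply: filterS2 lnear Enear => t lt nt.
  have Et : Es k t by apply: contrapT => nE; exact: nt.
  by split => _; [apply/(WE k z)|apply/(WE k t)].
have Enear : \forall t \near z, ~ Es k t by apply: open_nbhs_nbhs; split => //; exact: closed_openC.
apply: filterS2 lnear Enear => t lt nt.
by split => [/(WE k t lt)//|/(WE k z lz)].
Qed.

(** Pairs of equal height that stay off [v] and off the diagonal form countably many compact sets
    [K m]; each is covered by finitely many products of a [leg_clopen] set and its complement. *)
Lemma leg_clopen_sequence : exists W : nat -> set T,
  (forall n, leg_clopen (W n)) /\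
  forall x y, x <> v -> mu x = mu y -> x <> y -> exists n, W n x /\ ~ W n y.
Proof.
pose near_diag (m : nat) := [set p : T * T | ball p.1 (m.+1%:R^-1 : R) p.2].
(* Balls need not be open, so the interior of the near-diagonal is removed to keep [K m] closed. *)
pose K (m : nat) := [set p : T * T | m.+1%:R^-1 <= mu p.1] `&`
  [set p | mu p.1 - mu p.2 = 0] `&` ~` (near_diag m)°.
have cK m : compact (K m).
  apply: (subclosed_compact _ (compact_setX cT cT)); last by move=> p _; split.
  have c1 : continuous (fun p : T * T => mu p.1).
    by move=> p; apply: cvg_comp; [exact: cvg_fst|exact: mu_cont].
  have c2 : continuous (fun p : T * T => mu p.2).
    by move=> p; apply: cvg_comp; [exact: cvg_snd|exact: mu_cont].
  apply: closedI; last exact/open_closedC/open_interior.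
  apply: closedI.
    apply: (@preimage_closed (T * T)%type R _ [set t | m.+1%:R^-1 <= t]); last exact: closed_ge.
    by move=> p _; exact: c1.
  apply: (@preimage_closed (T * T)%type R (fun p => mu p.1 - mu p.2) [set t | t = 0]);
    last exact: closed_eq.
  by move=> p _; apply: cvgB; [exact: c1|exact: c2].
pose I := {W : set T | leg_clopen W}.
have lT : leg_clopen setT by move=> z _; apply: nearW.
pose i0 : I := exist _ setT lT.
pose U (i : I) := [set p : T * T | sval i p.1 /\ ~ sval i p.2].
have /choice[l lP] : forall m, exists l : seq I, forall p, K m p ->
    exists2 j, (j < size l)%N & U (nth i0 l j) p.
  move=> m; apply: compact_finite_subcover => // -[x y] [[/= mx mxy] nd].
  have {}mxy : mu x = mu y by lra.
  have m0 : 0 < m.+1%:R^-1 :> R by rewrite invr_gt0.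
  have x0 : 0 < mu x by exact: lt_le_trans mx.
  have xv : x <> v by move=> xv; move: x0; rewrite xv mu_v ltxx.
  have yv : y <> v by move=> yv; move: x0; rewrite mxy yv mu_v ltxx.
  have xy : x <> y.
    move=> xy; apply: nd; rewrite -xy; exists (ball x (m.+1%:R^-1 / 2), ball x (m.+1%:R^-1 / 2)).
      by split; apply: nbhsx_ballx; rewrite divr_gt0.
    move=> [a b] [/= xa xb]; rewrite /near_diag /= [m.+1%:R^-1]splitr.
    by apply: ball_triangle xb; exact: ball_sym.
  have [W [lW Wx Wy]] := separate_legs xv mxy xy.
  exists (exist _ W lW).
  exists (W, ~` W); last by move=> p [].
  split => /=.
    by apply: filterS (lW x xv) => t; tauto.
  by apply: filterS (lW y yv) => t; rewrite /setC /=; tauto.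
have [q qP] := enumerate_lists i0 l.
exists (fun n => sval (q n)); split => [n|x y xv mxy xy]; first exact: (svalP (q n)).
have [e e0 xye] : exists2 e : R, 0 < e & ~ ball x e y.
  apply: contrapT => H; apply: xy; apply: hT => A B /nbhs_ballP[e e0 xA] yB.
  exists y; split; last exact: nbhs_singleton.
  by apply: xA; apply: contrapT => nxy; apply: H; exists e.
have d0 : 0 < Num.min e (mu x) by rewrite lt_min e0 height_pos.
have [m] := ltr_add_invr d0; rewrite add0r lt_min => /andP[me mx].
have [|j jm [/= Wx Wy]] := lP m (x, y).
  split; first by split => /=; [exact: ltW|rewrite mxy subrr].
  by move=> /interior_subset; rewrite /near_diag /= => /(le_ball (ltW me)).
by have [k kP] := qP m j jm; exists k; rewrite kP.
Qed.

End Height.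

(** The bits record membership in the sets of [leg_clopen_sequence]; connectedness makes them
    constant along each arm off [v], and they separate points of equal height. *)
Lemma smooth_fan_coordinates : exists (mu : T -> R) (code : T -> nat -> bool),
  leg_coordinates v mu code /\
  forall e, e <> v -> end_points [set: T] e -> tip v mu code e.
Proof.
have [mu [mu_cont mu_v mu_lt]] := height_ex.
have [W [lW sepW]] := leg_clopen_sequence mu_cont mu_v mu_lt.
pose code x n := `[< W n x >].
have mu0 x : x <> v -> 0 < mu x by exact: height_pos.
have code_arm x y : arm x y -> y <> v -> code y =1 code x.
  move=> xy yv n; have [C [cC Cx Cy CP]] := arm_beyond xy.
  have Cv z : C z -> z <> v.
    move=> /CP[_ /(height_le mu_lt) zy] zv.
    by have := mu0 _ yv; rewrite zv mu_v in zy; move: zy; lra.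
  have loc z : C z -> \forall t \near z, W n t <-> W n z by move=> /Cv; exact: lW.
  apply/asbool_equiv_eq; split => H.
    exact: connected_locally_constant cC loc Cy Cx H.
  exact: connected_locally_constant cC loc Cx Cy H.
have inj x y : x <> v -> code x =1 code y -> mu x = mu y -> x = y.
  move=> xv cxy mxy; apply: contrapT => xy.
  have [n [Wx Wy]] := sepW x y xv mxy xy.
  by apply: Wy; apply/asboolP; rewrite -[asbool _]/(code y n) -cxy; apply/asboolP.
exists mu, code; split.
  split => //.
  - by move=> x; have [->|/mu0/ltW//] := pselect (x = v); rewrite mu_v.
  - move=> x; split => [mx|->//]; apply: contrapT => /mu0; rewrite mx ltxx.
    by [].
  - move=> x n xv; apply: filterS (lW n x xv) => t tx.
    exact/asbool_equiv_eq.
  - by move=> x y xv _; exact: inj.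
  - move=> x s s0 sx; have [|y xy my] := @arm_height mu mu_cont mu_v x s; first by rewrite ltW.
    exists y => //; apply: code_arm => // yv.
    by move: s0; rewrite -my yv mu_v ltxx.
(* A higher point [y] on the leg of [e] would place [e] in the interior of the arc [arm y], where no
   end point lies. *)
move=> e ev [_ ende]; split => // y cye; rewrite leNgt; apply/negP => ey.
have [|z yz mz] := @arm_height mu mu_cont mu_v y (mu e); first by rewrite !ltW ?mu0.
have zv : z <> v by move=> zv; have := mu0 _ ev; rewrite -mz zv mu_v ltxx.
have ze : z = e by apply: inj => // n; rewrite (code_arm _ _ yz zv) cye.
rewrite {}ze {zv mz} in yz.
have yv : y <> v by move=> yv; have := mu0 _ ev; rewrite yv mu_v in ey; lra.
have ay : is_arc (arm y) by exists v, y; exact: arm_arc.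
have [g [h [gh g0 g1]]] := arm_param yv.
have [he ge] := arm_mem gh yz.
have := ende _ (@subsetT _ _) ay yz; rewrite -ge; apply: (arc_interior_not_endpoint gh).
case/andP: he => he0 he1; apply/andP; split.
  rewrite lt_neqAle he0 andbT; apply/eqP => h0.
  by apply: ev; rewrite -ge -h0 g0.
rewrite lt_neqAle he1 andbT; apply/eqP => h1.
by move: ey; rewrite -ge h1 g1 ltxx.
Qed.

End SmoothFan.

(** * The two self-embeddings of a Lelek fan *)

Theorem mainTheorem5 (R : realType) (T : pseudoMetricType R) :
  metric_space T -> lelek_fan (setT : set T) ->
  (exists f : T -> T, [/\ embedding f, range f <> setT & admits_retraction f]) /\
  (exists f : T -> T, embedding f /\ ~ admits_retraction f).
Proof.
move=> hT [[v [[[[_ [cT _]] acT huT] ram1] ramv smoothT]] clE].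
(* A branch of the triod at [v] is an arc, whose other end differs from [v]. *)
have off_top : exists x, x <> v.
  have [A [_ [_ [_ _ _ [[b [g [h [_ _ _ hg [g0 g1]]]]] _] _]]]] := ramv.
  exists b => bv; have : (0 : R) = 1; last by apply/eqP; rewrite eq_sym oner_eq0.
  have u0 : @unit_itv R 0 by rewrite /unit_itv /=; lra.
  have u1 : @unit_itv R 1 by rewrite /unit_itv /=; lra.
  by rewrite -(hg 0 u0) -(hg 1 u1) g0 g1 bv.
have ramT w : ramification_point [set: T] w -> w = v by move=> rw; exact: ram1.
have [mu [code [HL tipP]]] := smooth_fan_coordinates hT cT acT huT ramT smoothT.
(* End points are dense; cutting the neighbourhood with the complement of [v] yields one that is a
   tip. *)
have tip_dense x U : x <> v -> nbhs x U -> exists2 e, U e & tip v mu code e.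
  move=> xv xU; have : closure (end_points [set: T]) x by rewrite clE.
  move=> /(_ _ (filterI xU (off_top_near HL xv)))[e [ende [Ue ev]]].
  by exists e => //; exact: tipP.
split.
  exists (scaled cT HL tip_dense off_top); split.
  - exact: scaled_embedding.
  - exact: scaled_not_surj.
  - exact: scaled_retraction.
exists (halve HL); split; first exact: halve_embedding.
exact: halve_no_retraction.
Qed.
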